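(* Let $f$ be a function on a perfect set $\mathfrak{F}$ in $\mathbb{C}$. Then $f\in \mathrm{CL}(\mathfrak{F})$ if and only if $f$ is differentiable in the complex sense at each point of $\mathfrak{F}$ and $\mathfrak{D}f\in\mathfrak{M}(\mathfrak{F}\times\mathfrak{F})$. Moreover, $\|f\|_{\mathrm{CL}(\mathfrak{F})}=\|\mathfrak{D}f\|_{\mathfrak{M}(\mathfrak{F}\times\mathfrak{F})}$.
   Context: A perfect set is a nonempty closed set without isolated points. Complex differentiability of $f$ at $z\in\mathfrak{F}$ means that the finite limit $f'(z)=\lim_{w\to z,\,w\in\mathfrak{F}}\frac{f(w)-f(z)}{w-z}$ exists. Commutator Lipschitz functions: $\mathrm{CL}(\mathfrak{F})$ is the space of continuous functions $f:\mathfrak{F}\to\mathbb{C}$ for which there is $C\ge0$ with $\|f(N)R-Rf(N)\|\le C\|NR-RN\|$ for every bounded operator $R$ and every bounded normal operator $N$ on Hilbert space with spectrum in $\mathfrak{F}$; $\|f\|_{\mathrm{CL}(\mathfrak{F})}$ is the smallest such $C$. Divided difference: $(\mathfrak{D}f)(z,w)=\frac{f(z)-f(w)}{z-w}$ for $z\ne w$ and $(\mathfrak{D}f)(z,z)=f'(z)$, $z,w\in\mathfrak{F}$. Discrete Schur multipliers: for arbitrary nonempty sets $\mathcal{S},\mathcal{T}$, $\mathcal{B}(\mathcal{S}\times\mathcal{T})$ is the space of matrices $\{a(s,t)\}_{(s,t)\in\mathcal{S}\times\mathcal{T}}$ inducing bounded operators from $\ell^2(\mathcal{T})$ to $\ell^2(\mathcal{S})$,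 with operator norm. A function $\Phi$ on $\mathcal{S}\times\mathcal{T}$ belongs to $\mathfrak{M}(\mathcal{S}\times\mathcal{T})$ if $\Phi\star A=\{\Phi(s,t)a(s,t)\}\in\mathcal{B}(\mathcal{S}\times\mathcal{T})$ for every $A\in\mathcal{B}(\mathcal{S}\times\mathcal{T})$, and $\|\Phi\|_{\mathfrak{M}(\mathcal{S}\times\mathcal{T})}=\sup\{\|\Phi\star A\|:\ \|A\|\le1\}$. *)

(* Defs.v *)
From HB Require Import structures.
From mathcomp Require Import all_boot all_order all_algebra finmap.
From mathcomp Require Import complex.
From mathcomp Require Import all_classical all_reals all_analysis summability.

Set Implicit Arguments.
Unset Strict Implicit.
Unset Printing Implicit Defensive.

Import Order.TTheory GRing.Theory Num.Theory.
Import numFieldNormedType.Exports.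

Local Open Scope classical_set_scope.
Local Open Scope ring_scope.

(* The library puts a topology on an abstract numFieldType only; this gives
   the concrete field R[i] the topology and norm of the modulus. *)
HB.instance Definition _ (R : rcfType) := PseudoPointedMetric.copy R[i] (R[i])^o.
HB.instance Definition _ (R : rcfType) := NormedModule.copy R[i] (R[i])^o.

(* `|v| lives in R[i]; rnorm v is the same number as an element of R. *)
Definition rnorm (R : realType) (V : normedModType R[i]) (v : V) : R :=
  complex.Re `|v|.

Record hilbertSpace (R : realType) := HilbertSpace {
  hilbert_car :> completeNormedModType R[i];
  hdot : {dot hilbert_car for Num.conj};
  hdot_norm : forall x, `|x| ^+ 2 = hdot x x }.

Section Operators.
Variables (R : realType) (H : hilbertSpace R).
Implicit Types (T N S : H -> H) (g h : R[i] -> R[i]).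

Definition bounded_op T : Prop :=
  linear T /\ exists M : R, forall x, rnorm (T x) <= M * rnorm x.

Definition opnorm T : \bar R :=
  ereal_sup [set (rnorm (T x))%:E | x in [set x | rnorm x <= 1]].

Definition is_adjoint T T' : Prop := forall x y, hdot H (T x) y = hdot H x (T' y).

Definition normal_op N : Prop := exists N',
  [/\ bounded_op N', is_adjoint N N' & forall x, N (N' x) = N' (N x)].

Definition spectrum N : set R[i] :=
  [set l | ~ exists S, [/\ bounded_op S,
     forall x, S (N x - l *: x) = x & forall x, N (S x) - l *: S x = x]].

(* The continuous functional calculus of N: a contractive unital
   star-homomorphism from C(spectrum N) to the bounded operators taking the
   identity function to N.  An element of C(spectrum N) is represented by any
   function on R[i] extending it; by contractivity Phi g depends only on the
   restriction of g to spectrum N.  For N normal, Phi exists and is unique on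
   the functions continuous on spectrum N. *)
Record is_functional_calculus N (Phi : (R[i] -> R[i]) -> H -> H) : Prop := {
  fc_bounded : forall g, {within spectrum N, continuous g} ->
    bounded_op (Phi g);
  fc_add : forall g h, {within spectrum N, continuous g} ->
    {within spectrum N, continuous h} ->
    forall x, Phi (fun z => g z + h z) x = Phi g x + Phi h x;
  fc_scale : forall (c : R[i]) g, {within spectrum N, continuous g} ->
    forall x, Phi (fun z => c * g z) x = c *: Phi g x;
  fc_mul : forall g h, {within spectrum N, continuous g} ->
    {within spectrum N, continuous h} ->
    forall x, Phi (fun z => g z * h z) x = Phi g (Phi h x);
  fc_one : forall x, Phi (fun=> 1) x = x;
  fc_star : forall g, {within spectrum N, continuous g} ->
    is_adjoint (Phi g) (Phi (fun z => (g z)^*));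
  fc_contractive : forall g (M : R), {within spectrum N, continuous g} ->
    0 <= M -> (forall z, spectrum N z -> rnorm (g z) <= M) ->
    forall x, rnorm (Phi g x) <= M * rnorm x;
  fc_id : forall x, Phi id x = N x }.

(* fN is the operator f(N) *)
Definition is_fun_of_op (f : R[i] -> R[i]) N (fN : H -> H) : Prop :=
  exists2 Phi, is_functional_calculus N Phi & fN = Phi f.

Definition commutator T S : H -> H := fun x => T (S x) - S (T x).

End Operators.

Section CommutatorLipschitz.
Variables (R : realType) (F : set R[i]) (f : R[i] -> R[i]).

Definition CL_bound (K : R) : Prop :=
  forall (H : hilbertSpace R) (N B fN : H -> H),
    bounded_op N -> normal_op N -> spectrum N `<=` F ->
    bounded_op B -> is_fun_of_op f N fN ->
    (opnorm (commutator fN B) <= K%:E * opnorm (commutator N B))%E.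

Definition CL : Prop :=
  {within F, continuous f} /\ exists2 K : R, 0 <= K & CL_bound K.

(* The infimum is a minimum when it is finite, since each constraint is a
   non-strict inequality linear in K; it is +oo when no K works. *)
Definition CL_norm : \bar R :=
  ereal_inf [set K%:E | K in [set K : R | 0 <= K /\ CL_bound K]].

End CommutatorLipschitz.

Section DividedDifference.
Variables (R : realType) (F : set R[i]) (f : R[i] -> R[i]).

(* z^' removes z, so these are limits along w in F with w <> z *)
Definition diff_quotient (z w : R[i]) : R[i] := (f w - f z) / (w - z).

Definition cdifferentiable_at (z : R[i]) : Prop :=
  cvg (diff_quotient z w @[w --> within F z^']).

Definition cderivative (z : R[i]) : R[i] :=
  lim (diff_quotient z w @[w --> within F z^']).

Definition divided_difference (z w : F) : R[i] :=
  if z == w then cderivative (val z)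
  else (f (val z) - f (val w)) / (val z - val w).

End DividedDifference.

Section SchurMultipliers.
Variables (R : realType).

Definition l2sum (I : choiceType) (x : I -> R[i]) : \bar R :=
  \esum_(i in [set: I]) ((rnorm (x i)) ^+ 2)%:E.

Definition l2 (I : choiceType) (x : I -> R[i]) : Prop := (l2sum x < +oo)%E.

Definition l2norm (I : choiceType) (x : I -> R[i]) : R :=
  Num.sqrt (fine (l2sum x)).

Variables (S T : choiceType).
Implicit Types (a Phi : S -> T -> R[i]) (x : T -> R[i]).

(* sums over T are unconditional, i.e. limits along the finite subsets of T *)
Definition mx_summable a x (s : S) : Prop :=
  cvg (partial_sum (fun t => a s t * x t) @ totally).

Definition mx_apply a x (s : S) : R[i] :=
  lim (partial_sum (fun t => a s t * x t) @ totally).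

Definition mx_bounded a : Prop :=
  (forall x, l2 x -> (forall s, mx_summable a x s) /\ l2 (mx_apply a x)) /\
  exists M : R, forall x, l2 x -> l2norm (mx_apply a x) <= M * l2norm x.

Definition mx_norm a : \bar R :=
  ereal_sup [set (l2norm (mx_apply a x))%:E | x in
    [set x | l2 x /\ l2norm x <= 1]].

Definition schur_product Phi a : S -> T -> R[i] := fun s t => Phi s t * a s t.

Definition schur_multiplier Phi : Prop :=
  forall a, mx_bounded a -> mx_bounded (schur_product Phi a).

Definition schur_norm Phi : \bar R :=
  ereal_sup [set mx_norm (schur_product Phi a) | a in
    [set a | mx_bounded a /\ (mx_norm a <= 1)%E]].

End SchurMultipliers.

(* Main.v *)
Require Import Defs.
From HB Require Import structures.
From mathcomp Require Import all_boot all_order all_algebra finmap.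
From mathcomp Require Import complex.
From mathcomp Require Import all_classical all_reals all_analysis summability.
From mathcomp Require Import ring lra.

(** Let D be the divided difference of f, and call K a bound of a Schur
    multiplier when it multiplies matrix norms by at most K. Both statements
    follow from: a number K >= 0 is a commutator Lipschitz constant of f if and
    only if f is differentiable along F and D is a Schur multiplier with the
    bound K ([CL_bound_differentiable], [CL_bound_schur_le] and
    [schur_le_CL_bound]). All matrix norms are read off finite sections, as
    bounds of bilinear forms ([mxform_le]).

    From commutators to multipliers. For a diagonal operator N with entries
    z p in F and a matrix B, the commutator of N and B has the entries
    (z p - z q) * B p q, and that of f N and B the entries
    (f (z p) - f (z q)) * B p q. Hence the Lipschitz inequality says that the
    matrix of the divided differences at finitely many points is a Schur
    multiplier with the bound K, on matrices that vanish where z p = z q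
    ([CL_bound_finite]); in particular, for two disjoint families of points, one
    for the rows and one for the columns, on all matrices ([CL_bound_rect]).

    Differentiability at z comes next. The difference quotients at z are
    bounded by K. If they did not converge, they would have two cluster points;
    take points of F that approach z very fast, those for the rows with a
    difference quotient near one cluster point, those for the columns with one
    near the other. The divided difference at a row point and a column point
    then depends, up to a small error, only on which is the farther from z.
    So a triangular matrix with two distinct values would be a Schur multiplier
    with the bound K, whatever its order. This is false because triangular
    truncation is unbounded: the Haar matrix of order 2 ^ k has norm at most
    sqrt k, while its entries below the diagonal have the sum - k 2 ^ k / 4
    ([haar_mx_norm], [haar_mx_lower]). Once f is differentiable, the diagonal
    entries of D are limits of divided differences at distinct points, since F
    has no isolated point.

    From multipliers to commutators. A Schur multiplier has a finite bound, by
    a gliding hump argument ([schur_multiplier_le]), and keeps it on matrices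
    whose entries are operators ([schur_le_forms]). For N normal with spectrum
    in F, take finitely many points s of F and continuous functions psi s, each
    supported near s, with squares of sum 1 on the spectrum. Then
    x |-> (psi s (N) x)_s is an isometry that carries N to approximately the
    diagonal operator of the points s, and f N to that of the values f s.
    Multiplying the block matrix of the commutator of N and B, with blocks
    (s - t) psi s (N) B psi t (N), by D gives that of the commutator of f N and
    B, whence the inequality in the limit. *)

Import Order.TTheory GRing.Theory Num.Theory.
Import numFieldNormedType.Exports.
Set Implicit Arguments.
Unset Strict Implicit.
Unset Printing Implicit Defensive.
Local Open Scope complex_scope.
Local Open Scope classical_set_scope.
Local Open Scope ring_scope.

(** * Moduli and norms as real numbers *)

Section Rnorm.
Variables (R : realType) (V : normedModType R[i]).
Implicit Types (u v w : V).

Lemma rnormE v : (rnorm v)%:C = `|v|.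
Proof. by rewrite /rnorm RRe_real// normr_real. Qed.

Lemma rnorm_ge0 v : 0 <= rnorm v.
Proof. by rewrite -ler0c rnormE. Qed.

Lemma rnormD_le u v : rnorm (u + v) <= rnorm u + rnorm v.
Proof. by rewrite -lecR rmorphD/= !rnormE ler_normD. Qed.

Lemma rnormN v : rnorm (- v) = rnorm v.
Proof. by rewrite /rnorm normrN. Qed.

Lemma rnormB_le u v : rnorm (u - v) <= rnorm u + rnorm v.
Proof. by rewrite -(rnormN v) rnormD_le. Qed.

Lemma rnormBC u v : rnorm (u - v) = rnorm (v - u).
Proof. by rewrite -rnormN opprB. Qed.

Lemma rnorm_triangle u v w : rnorm (u - w) <= rnorm (u - v) + rnorm (v - w).
Proof. by rewrite (le_trans _ (rnormD_le _ _))// addrA subrK. Qed.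

Lemma rnorm0 : rnorm (0 : V) = 0.
Proof. by rewrite /rnorm normr0. Qed.

Lemma rnorm_eq0 v : rnorm v = 0 -> v = 0.
Proof. by move=> v0; apply/eqP; rewrite -normr_eq0 -rnormE v0. Qed.

Lemma rnorm_le0 v : rnorm v <= 0 -> v = 0.
Proof. by move=> v0; apply/rnorm_eq0/eqP; rewrite eq_le v0 rnorm_ge0. Qed.

Lemma rnorm_sum (I : Type) (r : seq I) (P : pred I) (F : I -> V) :
  rnorm (\sum_(i <- r | P i) F i) <= \sum_(i <- r | P i) rnorm (F i).
Proof.
elim/big_rec2 : _ => [|i x y _ xy]; first by rewrite rnorm0.
by rewrite (le_trans (rnormD_le _ _))// lerD2l.
Qed.

Lemma nbhs_rnormP (v : V) (A : set V) :
  nbhs v A <-> exists2 e : R, 0 < e & forall w, rnorm (v - w) < e -> A w.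
Proof.
split=> [/nbhs_normP[e /= e0 eA]|[e e0 eA]].
  have eE : e = (complex.Re e)%:C by rewrite RRe_real// gtr0_real.
  exists (complex.Re e) => [|w vw]; first by rewrite -ltcR -eE.
  by apply: eA; rewrite /ball_/= -rnormE eE ltcR.
apply/nbhs_normP; exists e%:C; first by rewrite /= ltcR.
by move=> w; rewrite /ball_/= -rnormE ltcR => /eA.
Qed.

Lemma cvg_rnormP (T : Type) (G : set_system T) {FF : Filter G} (g : T -> V) v :
  g @ G --> v <-> forall e : R, 0 < e -> \forall x \near G, rnorm (v - g x) < e.
Proof.
split=> [gv e e0|gv A /nbhs_rnormP[e e0 eA]].
  by apply: (gv [set w | rnorm (v - w) < e]); apply/nbhs_rnormP; exists e.
by apply: filterS (gv e e0) => x /= /eA.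
Qed.

Lemma rnorm_cvg (T : Type) (G : set_system T) {FF : Filter G} (g : T -> V) v :
  (forall e : R, 0 < e -> \forall x \near G, rnorm (v - g x) < e) -> g @ G --> v.
Proof. by move/cvg_rnormP. Qed.

End Rnorm.

Section RnormScalar.
Variables (R : realType).
Implicit Types (x y z c : R[i]).

Lemma rnormZ (V : normedModType R[i]) c (v : V) : rnorm (c *: v) = rnorm c * rnorm v.
Proof. by apply: complexI; rewrite rmorphM/= !rnormE normrZ. Qed.

Lemma rnormM x y : rnorm (x * y) = rnorm x * rnorm y.
Proof. by apply: complexI; rewrite rmorphM/= !rnormE normrM. Qed.

Lemma rnorm1 : rnorm (1 : R[i]) = 1.
Proof. by apply: complexI; rewrite !rnormE normr1. Qed.

Lemma rnormV x : rnorm x^-1 = (rnorm x)^-1.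
Proof. by apply: complexI; rewrite fmorphV/= !rnormE normfV. Qed.

Lemma rnorm_sqr x : rnorm x ^+ 2 = complex.Re x ^+ 2 + complex.Im x ^+ 2.
Proof. by apply: complexI; rewrite rmorphXn/= rnormE add_Re2_Im2. Qed.

Lemma rnorm_conj x : rnorm x^* = rnorm x.
Proof. by apply: complexI; rewrite !rnormE norm_conjC. Qed.

Lemma mulC_conj x : x * x^* = (rnorm x ^+ 2)%:C.
Proof. by rewrite -normCK rmorphXn/= rnormE. Qed.

Lemma rnorm_real (r : R) : rnorm r%:C = `|r|.
Proof.
apply/eqP; rewrite -(eqrXn2 (n := 2))//; last exact: rnorm_ge0.
by rewrite rnorm_sqr/= expr0n/= addr0 real_normK// num_real.
Qed.

Lemma normr_Re_le x : `|complex.Re x| <= rnorm x.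
Proof. by rewrite -lecR rnormE normc_ge_Re. Qed.

Lemma normr_Im_le x : `|complex.Im x| <= rnorm x.
Proof.
rewrite -(ler_pXn2r (n := 2))// ?nnegrE ?rnorm_ge0//.
by rewrite real_normK ?num_real// rnorm_sqr lerDr sqr_ge0.
Qed.

Lemma rnorm_le_ReIm x : rnorm x <= `|complex.Re x| + `|complex.Im x|.
Proof.
rewrite -(ler_pXn2r (n := 2))// ?nnegrE ?rnorm_ge0 ?addr_ge0//.
rewrite rnorm_sqr sqrrD !real_normK ?num_real// addrAC lerDl.
by rewrite pmulrn_lge0// mulr_ge0.
Qed.

(** The modulus metric on R[i] is complete because the real and imaginary
    parts of a Cauchy filter are Cauchy filters of R. *)
Lemma complex_cauchy_cvg (T : Type) (G : set_system T) {FF : ProperFilter G}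
    (g : T -> R[i]) :
  (forall e : R, 0 < e -> exists z : R[i], \forall x \near G, rnorm (z - g x) < e) ->
  exists l : R[i], g @ G --> l.
Proof.
move=> gC.
have part (h : R[i] -> R) : (forall x y, `|h x - h y| <= rnorm (x - y)) ->
    exists l : R, (h \o g) @ G --> l.
  move=> hle; apply/cvg_ex; apply: cauchy_cvg; apply: cauchy_exP => e e0.
  have [z zG] := gC e e0; exists (h z); apply: filterS zG => x xe.
  by rewrite /ball/=; apply: le_lt_trans (hle _ _) xe.
have [a ga] : exists l : R, (@complex.Re R \o g) @ G --> l.
  by apply: part => x y; rewrite -raddfB normr_Re_le.
have [b gb] : exists l : R, (@complex.Im R \o g) @ G --> l.
  by apply: part => x y; rewrite -raddfB normr_Im_le.
exists (a +i* b); apply/cvg_rnormP => e e0.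
have e20 : 0 < e / 2 by rewrite divr_gt0.
move/cvgrPdist_lt/(_ _ e20) : ga => ga; move/cvgrPdist_lt/(_ _ e20) : gb => gb.
near=> x; apply: le_lt_trans (rnorm_le_ReIm _) _; rewrite !raddfB/= (splitr e).
by apply: ltrD; near: x.
Unshelve. all: by end_near. Qed.

End RnormScalar.

(** * Cauchy-Schwarz inequalities for finite sums *)

Section FiniteSums.
Variables (R : realType).

Lemma cauchy_schwarz_sqr (I : Type) (r : seq I) (a b : I -> R) :
  (\sum_(i <- r) a i * b i) ^+ 2 <=
  (\sum_(i <- r) a i ^+ 2) * (\sum_(i <- r) b i ^+ 2).
Proof.
set S := \sum_(i <- r) a i * b i; set A := \sum_(i <- r) a i ^+ 2.
set B := \sum_(i <- r) b i ^+ 2.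
have Q t u : 0 <= t ^+ 2 * A - 2 * t * u * S + u ^+ 2 * B.
  suff -> : t ^+ 2 * A - 2 * t * u * S + u ^+ 2 * B =
            \sum_(i <- r) (t * a i - u * b i) ^+ 2.
    by apply: sumr_ge0 => i _; exact: sqr_ge0.
  rewrite /A /B /S !mulr_sumr -sumrB -big_split/=; apply: eq_bigr => i _; ring.
have A0 : 0 <= A by apply: sumr_ge0 => i _; exact: sqr_ge0.
have B0 : 0 <= B by apply: sumr_ge0 => i _; exact: sqr_ge0.
case: (ltP 0 A) => [A1|A1].
  have := Q S A; have -> : S ^+ 2 * A - 2 * S * A * S + A ^+ 2 * B =
    A * (A * B - S ^+ 2) by ring.
  by rewrite pmulr_rge0// subr_ge0.
case: (ltP 0 B) => [B1|B1].
  have := Q B S; have -> : B ^+ 2 * A - 2 * B * S * S + S ^+ 2 * B =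
    B * (A * B - S ^+ 2) by ring.
  by rewrite pmulr_rge0// subr_ge0.
have A_eq0 : A = 0 by apply/le_anti; rewrite A0 A1.
have B_eq0 : B = 0 by apply/le_anti; rewrite B0 B1.
have := Q 1 1; have := Q 1 (-1); rewrite A_eq0 B_eq0 => S1 S2.
by have -> : S = 0 by lra.

Qed.

Definition l2fin (I : Type) (r : seq I) (x : I -> R[i]) : R :=
  Num.sqrt (\sum_(i <- r) rnorm (x i) ^+ 2).

Lemma sum_sqr_ge0 (I : Type) (r : seq I) (x : I -> R) :
  0 <= \sum_(i <- r) x i ^+ 2.
Proof. by apply: sumr_ge0 => i _; exact: sqr_ge0. Qed.

Lemma l2fin_ge0 (I : Type) (r : seq I) x : 0 <= l2fin r x.
Proof. exact: sqrtr_ge0. Qed.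

Lemma sqr_l2fin (I : Type) (r : seq I) x :
  l2fin r x ^+ 2 = \sum_(i <- r) rnorm (x i) ^+ 2.
Proof. by rewrite sqr_sqrtr// sum_sqr_ge0. Qed.

Lemma eq_l2fin (I : eqType) (r : seq I) x x' :
  {in r, forall i, rnorm (x i) = rnorm (x' i)} -> l2fin r x = l2fin r x'.
Proof. by move=> e; congr Num.sqrt; apply: eq_big_seq => i /e ->. Qed.

Lemma cauchy_schwarz_sum (I : Type) (r : seq I) (a b : I -> R) :
  \sum_(i <- r) a i * b i <=
  Num.sqrt (\sum_(i <- r) a i ^+ 2) * Num.sqrt (\sum_(i <- r) b i ^+ 2).
Proof.
rewrite -sqrtrM ?sum_sqr_ge0//; apply: le_trans (ler_norm _) _.
by rewrite -sqrtr_sqr ler_sqrt ?mulr_ge0 ?sum_sqr_ge0// cauchy_schwarz_sqr.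
Qed.

Lemma cauchy_schwarz_l2fin (I : Type) (r : seq I) (x y : I -> R[i]) :
  rnorm (\sum_(i <- r) x i * y i) <= l2fin r x * l2fin r y.
Proof.
apply: le_trans (rnorm_sum _ _ _) _.
under eq_bigr do rewrite rnormM; exact: cauchy_schwarz_sum.
Qed.

(** The supremum over y is attained at the conjugate of x. *)
Lemma l2fin_dual (I : Type) (r : seq I) (x : I -> R[i]) c : 0 <= c ->
  (forall y, rnorm (\sum_(i <- r) x i * y i) <= c * l2fin r y) ->
  l2fin r x <= c.
Proof.
move=> c0 /(_ (fun i => (x i)^*)).
have -> : l2fin r (fun i => (x i)^*) = l2fin r x.
  by congr Num.sqrt; apply: eq_bigr => i _; rewrite rnorm_conj.
under eq_bigr do rewrite mulC_conj.
rewrite -rmorph_sum/= -sqr_l2fin rnorm_real ger0_norm ?sqr_ge0// expr2.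
have := l2fin_ge0 r x; rewrite le_eqVlt => /predU1P[<-//|x0].
by rewrite ler_pM2r.
Qed.

Lemma l2finZ (I : Type) (r : seq I) c (x : I -> R[i]) :
  l2fin r (fun i => c * x i) = rnorm c * l2fin r x.
Proof.
rewrite /l2fin; under eq_bigr do rewrite rnormM exprMn.
by rewrite -mulr_sumr sqrtrM ?sqr_ge0// sqrtr_sqr ger0_norm ?rnorm_ge0.
Qed.

Lemma l2finD (I : Type) (r : seq I) (x y : I -> R[i]) :
  l2fin r (fun i => x i + y i) <= l2fin r x + l2fin r y.
Proof.
apply: l2fin_dual => [|z]; first by rewrite addr_ge0 ?l2fin_ge0.
under eq_bigr do rewrite mulrDl.
rewrite big_split/= mulrDl; apply: le_trans (rnormD_le _ _) _.
by apply: lerD; exact: cauchy_schwarz_l2fin.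
Qed.

Lemma le_l2fin (I : eqType) (r : seq I) (x : I -> R[i]) i :
  i \in r -> rnorm (x i) <= l2fin r x.
Proof.
move=> ir; rewrite -[leLHS]ger0_norm ?rnorm_ge0// -sqrtr_sqr.
rewrite ler_sqrt ?sum_sqr_ge0//.
by rewrite (perm_big _ (perm_to_rem ir))/= big_cons lerDl sum_sqr_ge0.
Qed.

End FiniteSums.

(** * Bounded matrices and their finite sections *)

#[local] Existing Instance totally_filter.

Section L2.
Variables (R : realType) (I : choiceType).
Implicit Types (x : I -> R[i]) (E A : {fset I}).

Lemma sum_fset_subset (V : zmodType) (F : I -> V) E A : (E `<=` A)%fset ->
  \sum_(i <- A) F i = \sum_(i <- E) F i + \sum_(i <- (A `\` E)%fset) F i.
Proof.
move=> EA; rewrite (big_fsetID _ (fun i => i \in E))/=.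
have -> : [fset i in A | i \in E]%fset = E.
  apply/fsetP => i; rewrite !inE andbC.
  by case: (boolP (i \in E)) => // /(fsubsetP EA) ->.
by have -> : [fset i in A | i \notin E]%fset = (A `\` E)%fset
  by apply/fsetP => i; rewrite !inE andbC.
Qed.

Lemma l2fin_subset E A x : (E `<=` A)%fset -> l2fin E x <= l2fin A x.
Proof.
move=> EA; rewrite ler_sqrt ?sum_sqr_ge0//.
by rewrite (sum_fset_subset (fun i => rnorm (x i) ^+ 2) EA) lerDl sum_sqr_ge0.
Qed.

Lemma l2sum_fset_le E x : ((\sum_(i <- E) rnorm (x i) ^+ 2)%:E <= l2sum x)%E.
Proof.
rewrite /l2sum -sumEFin; apply: esum_ge; exists [set` E].
  by split=> //; exact: finite_fset.
by rewrite fsbig_finite ?set_fsetK//; exact: finite_fset.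
Qed.

Lemma l2sum_ge0 x : (0 <= l2sum x)%E.
Proof. by apply: esum_ge0 => i _; rewrite lee_fin sqr_ge0. Qed.

Lemma l2fin_le_l2norm x E : l2 x -> l2fin E x <= l2norm x.
Proof.
move=> x2; rewrite /l2fin /l2norm ler_sqrt ?fine_ge0 ?l2sum_ge0//.
by rewrite -lee_fin fineK ?l2sum_fset_le// ge0_fin_numE ?l2sum_ge0.
Qed.

Lemma l2norm_ge0 x : 0 <= l2norm x. Proof. exact: sqrtr_ge0. Qed.

Lemma l2_le x c : 0 <= c -> (forall E, l2fin E x <= c) -> l2 x /\ l2norm x <= c.
Proof.
move=> c0 xc.
have xc2 : (l2sum x <= (c ^+ 2)%:E)%E.
  apply: ge_ereal_sup => _ [X [finX _] <-]; rewrite fsbig_finite// sumEFin lee_fin.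
  by rewrite -sqr_l2fin ler_pXn2r// nnegrE l2fin_ge0.
have x2 : l2 x by apply: le_lt_trans xc2 _; rewrite ltry.
split=> //; rewrite -[c]ger0_norm// -sqrtr_sqr ler_sqrt ?sqr_ge0//.
by rewrite -lee_fin fineK// ge0_fin_numE ?l2sum_ge0.
Qed.

Lemma l2fin_support x E A : (forall i, i \notin E -> x i = 0) ->
  l2fin A x <= l2fin E x.
Proof.
move=> xE; apply: le_trans (l2fin_subset x (fsubsetUl A E)) _.
rewrite ler_sqrt ?sum_sqr_ge0//.
rewrite (sum_fset_subset (fun i => rnorm (x i) ^+ 2) (fsubsetUr A E)).
rewrite [X in _ + X]big_seq [X in _ + X]big1 ?addr0// => i; rewrite !inE => /andP[iE _].
by rewrite xE// rnorm0 expr0n.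
Qed.

(** The supremum [l2sum x] is approached on finite sets, so that nothing much is
    left off one of them; this is what makes the row sums of a bounded matrix
    converge unconditionally. *)
Lemma l2_tail x (e : R) : l2 x -> 0 < e ->
  exists E, forall A, (E `<=` A)%fset -> l2fin (A `\` E)%fset x < e.
Proof.
move=> x2 e0.
have xfin : l2sum x \is a fin_num by rewrite ge0_fin_numE ?l2sum_ge0.
have e20 : 0 < e ^+ 2 by rewrite exprn_gt0.
have [_ [X [finX _] <-]] := ub_ereal_sup_adherent e20 xfin.
rewrite fsbig_finite// sumEFin => Xlt; exists (fset_set X) => A XA.
rewrite -[e]gtr0_norm// -sqrtr_sqr ltr_sqrt//.
have := l2sum_fset_le A x; rewrite (sum_fset_subset _ XA) => Ale.
move: Xlt Ale; rewrite -[ereal_sup _]/(l2sum x) -(fineK xfin) -EFinB lte_fin lee_fin; lra.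
Qed.

Lemma partial_sumE (V : zmodType) (F : I -> V) E : partial_sum F E = \sum_(i <- E) F i.
Proof. by rewrite /partial_sum [RHS]big_seq_fsetE. Qed.

Lemma near_totally E : \forall A \near @totally I, (E `<=` A)%fset.
Proof. by exists E. Qed.

Lemma partial_sum_support (F : I -> R[i]) E : (forall i, i \notin E -> F i = 0) ->
  partial_sum F @ totally --> \sum_(i <- E) F i.
Proof.
move=> F0; apply: rnorm_cvg => e e0; apply: filterS (near_totally E) => A EA.
rewrite partial_sumE (sum_fset_subset _ EA).
rewrite opprD addNKr rnormN big_seq big1 ?rnorm0// => i.
by rewrite !inE => /andP[/F0].
Qed.

End L2.

Lemma rnorm_lim_le (R : realType) (V : normedModType R[i]) (T : Type)
    (G : set_system T) {FF : ProperFilter G} (g : T -> V) (v : V) (c : R) :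
  g @ G --> v -> (\forall x \near G, rnorm (g x) <= c) -> rnorm v <= c.
Proof.
move=> /cvg_rnormP gv gc; apply/ler_addgt0Pr => e e0.
have [x [gx gxc]] := filter_ex (filterI (gv e e0) gc).
rewrite -(subrK (g x) v) addrC; apply: le_trans (rnormD_le _ _) _.
by rewrite lerD// ltW.
Qed.

Section BoundedMatrices.
Variables (R : realType) (S T : choiceType).
Implicit Types (a b : S -> T -> R[i]) (x : T -> R[i]) (y : S -> R[i]).
Implicit Types (E : {fset S}) (G : {fset T}) (M : R).

Definition mxform E G a x y : R[i] :=
  \sum_(s <- E) \sum_(t <- G) a s t * x t * y s.

(** The operator norm bound, read off the finite sections of the bilinear
    form; it involves no convergence. *)
Definition mxform_le a M : Prop := 0 <= M /\
  forall E G x y, rnorm (mxform E G a x y) <= M * l2fin G x * l2fin E y.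

Lemma mxformE E G a x y :
  mxform E G a x y = \sum_(s <- E) (\sum_(t <- G) a s t * x t) * y s.
Proof. by apply: eq_bigr => s _; rewrite mulr_suml. Qed.

Lemma mxform_le_entry a M s t : mxform_le a M -> rnorm (a s t) <= M.
Proof.
move=> [M0 /(_ [fset s]%fset [fset t]%fset (fun=> 1) (fun=> 1))].
rewrite /mxform /l2fin !big_seq_fset1 rnorm1 !expr1n sqrtr1.
by rewrite !mulr1.
Qed.

Lemma mxform_le_row a M s G x : mxform_le a M ->
  rnorm (\sum_(t <- G) a s t * x t) <= M * l2fin G x.
Proof.
move=> [M0 /(_ [fset s]%fset G x (fun=> 1))].
rewrite mxformE /l2fin !big_seq_fset1 rnorm1 !expr1n sqrtr1.
by rewrite !mulr1.
Qed.

Lemma mxform_le_summable a M x s : mxform_le a M -> l2 x -> mx_summable a x s.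
Proof.
move=> aM x2; apply/cvg_ex; apply: complex_cauchy_cvg => e e0.
have M1 : 0 < M + 1 by rewrite ltr_wpDl//; case: aM.
have [G GP] := l2_tail x2 (divr_gt0 e0 M1).
exists (\sum_(t <- G) a s t * x t); apply: filterS (near_totally G) => A GA.
rewrite partial_sumE (sum_fset_subset _ GA) opprD addNKr rnormN.
apply: le_lt_trans (mxform_le_row _ _ _ aM) _.
have := GP _ GA; rewrite ltr_pdivlMr//; apply: le_lt_trans.
by rewrite mulrC ler_wpM2l ?l2fin_ge0// lerDl.
Qed.

(** The norm of the image is the supremum of its pairings with finitely
    supported vectors y, and these are limits of the bilinear form. *)
Lemma mxform_le_bounded a M : mxform_le a M ->
  mx_bounded a /\ forall x, l2 x -> l2norm (mx_apply a x) <= M * l2norm x.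
Proof.
move=> aM; have M0 := aM.1.
have main x : l2 x -> l2 (mx_apply a x) /\ l2norm (mx_apply a x) <= M * l2norm x.
  move=> x2; apply: l2_le => [|E]; first by rewrite mulr_ge0 ?l2norm_ge0.
  apply: l2fin_dual => [|y]; first by rewrite mulr_ge0 ?l2norm_ge0.
  have : (fun G => \sum_(s <- E) partial_sum (fun t => a s t * x t) G * y s)
      @ totally --> \sum_(s <- E) mx_apply a x s * y s.
    apply: cvg_big => [z|s _]; first exact: add_continuous.
    apply: cvgMl; exact: mxform_le_summable aM x2.
  move=> /rnorm_lim_le; apply; apply: nearW => G.
  under eq_bigr do rewrite partial_sumE; rewrite -mxformE.
  apply: le_trans (aM.2 _ _ _ _) _; rewrite ler_wpM2r ?l2fin_ge0//.
  by rewrite ler_wpM2l// l2fin_le_l2norm.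
split=> [|x /main[]//]; split=> [x x2|].
  by split=> [s|]; [exact: mxform_le_summable aM x2|exact: (main x x2).1].
by exists M => x /main[].
Qed.

Lemma mxformZ E G a c d x y :
  mxform E G a (fun t => c * x t) (fun s => d * y s) = c * d * mxform E G a x y.
Proof.
rewrite /mxform mulr_sumr; apply: eq_bigr => s _.
by rewrite mulr_sumr; apply: eq_bigr => t _; ring.
Qed.

Lemma mxform_le_unit a (M : R) : 0 <= M ->
  (forall E G x y, l2fin G x <= 1 -> l2fin E y <= 1 ->
    rnorm (mxform E G a x y) <= M) -> mxform_le a M.
Proof.
move=> M0 aM; split=> // E G x y.
have normal (I : choiceType) (A : {fset I}) (z : I -> R[i]) :
    exists2 z' : I -> R[i], l2fin A z' <= 1 & {in A, z =1 fun i => (l2fin A z)%:C * z' i}.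
  have [z0|z0] := eqVneq (l2fin A z) 0.
    exists (fun=> 0) => [|i iA].
      rewrite /l2fin big1 ?sqrtr0 ?ler01// => i _.
      by rewrite rnorm0 expr0n.
    by rewrite mulr0; apply: rnorm_le0; rewrite -z0 le_l2fin.
  exists (fun i => (l2fin A z)^-1%:C * z i) => [|i iA].
    rewrite l2finZ rnorm_real ger0_norm ?invr_ge0 ?l2fin_ge0//.
    by rewrite mulVf.
  by rewrite mulrA -rmorphM/= divff// mul1r.
have [x' x'1 xE] := normal _ G x; have [y' y'1 yE] := normal _ E y.
have -> : mxform E G a x y =
  mxform E G a (fun t => (l2fin G x)%:C * x' t) (fun s => (l2fin E y)%:C * y' s).
  by apply: eq_big_seq => s sE; apply: eq_big_seq => t tG; rewrite xE// yE.
rewrite mxformZ !rnormM !rnorm_real !ger0_norm ?l2fin_ge0//.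
rewrite mulrC mulrA ler_wpM2r ?l2fin_ge0// ler_wpM2r ?l2fin_ge0//.
exact: aM.
Qed.

Lemma mx_norm_le a M : mxform_le a M -> (Defs.mx_norm a <= M%:E)%E.
Proof.
move=> aM; apply: ge_ereal_sup => _ [x /= [x2 x1] <-]; rewrite lee_fin.
apply: le_trans ((mxform_le_bounded aM).2 x x2) _.
by rewrite ler_piMr//; case: aM.
Qed.

Lemma mx_norm_mxform_le a M : 0 <= M -> mx_bounded a -> (Defs.mx_norm a <= M%:E)%E ->
  mxform_le a M.
Proof.
move=> M0 [ab _] aM; apply: mxform_le_unit => // E G x y x1 y1.
pose x' t := if t \in G then x t else 0.
have x'0 t : t \notin G -> x' t = 0 by rewrite /x' => /negbTE ->.
have [x'2 x'1] : l2 x' /\ l2norm x' <= 1.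
  have l2finE : l2fin G x' = l2fin G x.
    by apply: eq_l2fin => t tG; rewrite /x' tG.
  apply: l2_le => // A; apply: le_trans x1; rewrite -l2finE.
  exact: l2fin_support.
have applyE s : mx_apply a x' s = \sum_(t <- G) a s t * x t.
  rewrite /mx_apply; apply: norm_cvg_lim.
  have -> : \sum_(t <- G) a s t * x t = \sum_(t <- G) a s t * x' t.
    by apply: eq_big_seq => t tG; rewrite /x' tG.
  by apply: partial_sum_support => t /x'0 ->; rewrite mulr0.
rewrite mxformE; under eq_bigr do rewrite -applyE.
apply: le_trans (cauchy_schwarz_l2fin _ _ _) _; rewrite -[leRHS]mulr1.
apply: ler_pM; rewrite ?l2fin_ge0//.
apply: le_trans (l2fin_le_l2norm _ (ab x' x'2).2) _; rewrite -lee_fin.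
by apply: le_trans aM; apply: ereal_sup_ubound; exists x'.
Qed.

Lemma mx_bounded_mxform_le a : mx_bounded a -> exists M, mxform_le a M.
Proof.
move=> ab; have [_ [M aM]] := ab; exists `|M|; apply: mx_norm_mxform_le => //.
apply: ge_ereal_sup => _ [x /= [x2 x1] <-]; rewrite lee_fin.
apply: le_trans (aM x x2) _; apply: le_trans (ler_wpM2r (l2norm_ge0 x) (ler_norm M)) _.
by rewrite ler_piMr.
Qed.

Lemma mx_norm_ge0 a : (0 <= Defs.mx_norm a)%E.
Proof.
have [z2 z0] : l2 ((fun=> 0) : T -> R[i]) /\ l2norm ((fun=> 0) : T -> R[i]) <= 0.
  apply: l2_le => // E; rewrite /l2fin big1 ?sqrtr0// => t _.
  by rewrite rnorm0 expr0n.
apply: le_trans (ereal_sup_ubound _); last first.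
  by exists (fun=> 0) => //=; split=> //; apply: le_trans z0 ler01.
by rewrite lee_fin l2norm_ge0.
Qed.

End BoundedMatrices.

(** * Uniform boundedness of Schur multipliers *)

Section SchurBound.
Variables (R : realType) (S T : choiceType).
Implicit Types (Phi a b : S -> T -> R[i]) (x : T -> R[i]) (y : S -> R[i]).
Implicit Types (E : {fset S}) (G : {fset T}).

Definition schur_le Phi (K : R) : Prop := 0 <= K /\
  forall a M, mxform_le a M -> mxform_le (schur_product Phi a) (K * M).

Lemma mxform_lin E G a b c x y :
  mxform E G (fun s t => a s t + c * b s t) x y =
  mxform E G a x y + c * mxform E G b x y.
Proof.
rewrite /mxform mulr_sumr -big_split/=; apply: eq_bigr => s _.
by rewrite mulr_sumr -big_split/=; apply: eq_bigr => t _; ring.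
Qed.

Lemma mxform_scale E G a c x y :
  mxform E G (fun s t => c * a s t) x y = c * mxform E G a x y.
Proof.
rewrite /mxform mulr_sumr; apply: eq_bigr => s _.
by rewrite mulr_sumr; apply: eq_bigr => t _; ring.
Qed.

Lemma mxform_leD a b c (M N : R) : mxform_le a M -> mxform_le b N ->
  mxform_le (fun s t => a s t + c * b s t) (M + rnorm c * N).
Proof.
move=> [M0 aM] [N0 bN]; split=> [|E G x y].
  by rewrite addr_ge0// mulr_ge0// rnorm_ge0.
rewrite mxform_lin !mulrDl; apply: le_trans (rnormD_le _ _) _.
by rewrite lerD// rnormM -!mulrA ler_wpM2l ?rnorm_ge0// mulrA.
Qed.

Lemma mxform_leW a (M N : R) : M <= N -> mxform_le a M -> mxform_le a N.
Proof.
move=> MN [M0 aM]; split=> [|E G x y]; first exact: le_trans MN.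
by apply: le_trans (aM _ _ _ _) _; rewrite -!mulrA ler_wpM2r// mulr_ge0 ?l2fin_ge0.
Qed.

Lemma mxform_le_scale a (M c : R) : 0 <= c -> mxform_le a M ->
  mxform_le (fun s t => c%:C * a s t) (c * M).
Proof.
move=> c0 [M0 aM]; split=> [|E G x y]; first exact: mulr_ge0.
by rewrite mxform_scale rnormM rnorm_real ger0_norm// -!mulrA ler_wpM2l// mulrA.
Qed.

Lemma schur_le_unit Phi (K : R) : 0 <= K ->
  (forall a, mxform_le a 1 -> mxform_le (schur_product Phi a) K) ->
  schur_le Phi K.
Proof.
move=> K0 PhiK; split=> // a M aM.
have [M0|M0] := eqVneq M 0.
  have a0 s t : a s t = 0.
    by apply: rnorm_le0; rewrite -M0; exact: mxform_le_entry aM.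
  rewrite M0 mulr0; apply: mxform_le_unit => // E G x y _ _.
  rewrite /mxform big1 ?rnorm0// => s _; rewrite big1// => t _.
  by rewrite /schur_product a0 mulr0 !mul0r.
have Mge0 := aM.1; have MV0 : 0 <= M^-1 by rewrite invr_ge0.
have /PhiK PaK : mxform_le (fun s t => M^-1%:C * a s t) 1.
  by rewrite -(mulVf M0); exact: mxform_le_scale.
have := mxform_le_scale Mge0 PaK; rewrite mulrC.
congr mxform_le; apply/funext => s; apply/funext => t.
rewrite /schur_product mulrCA; congr (_ * _).
by rewrite mulrA -rmorphM/= divff// mul1r.
Qed.

(** A gliding hump: if no constant works, one builds a convergent series of
    matrices whose sum is bounded although its Schur product is not. At each
    step the coefficient c of the next matrix is so small that the rest of the
    series cannot disturb the large values already obtained. *)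
Lemma schur_multiplier_le Phi : schur_multiplier Phi -> exists K, schur_le Phi K.
Proof.
move=> Phi_mult; apply/not_existsP => Phi_unbounded.
have hump (K : R) : 0 <= K -> exists a, mxform_le a 1 /\
    exists E G x y, [/\ l2fin G x <= 1, l2fin E y <= 1 &
      K < rnorm (mxform E G (schur_product Phi a) x y)].
  move=> K0; apply/not_existsP => small; apply: (Phi_unbounded K).
  apply: schur_le_unit => // a a1; apply: mxform_le_unit => // E G x y x1 y1.
  rewrite leNgt; apply/negP => big; apply: (small a); split=> //.
  by exists E, G, x, y.
(* a state is a partial sum of the series with the next coefficient; the last
   clause says that what is added later changes the form by at most p.2 *)
pose step n (p q : (S -> T -> R[i]) * R) := [/\ 0 < q.2, q.2 <= p.2 / 2,
  mxform_le (fun s t => q.1 s t - p.1 s t) p.2 & exists E G x y,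
  [/\ l2fin G x <= 1, l2fin E y <= 1,
      n.+2%:R < rnorm (mxform E G (schur_product Phi q.1) x y) &
      forall m : S -> T -> R[i], (forall s t, rnorm (m s t) <= 2 * q.2) ->
        rnorm (mxform E G (schur_product Phi m) x y) <= p.2]].
have stepP n p : 0 < p.2 -> exists q, step n p q.
  case: p => a c /= c0.
  have [|b [b1 [E [G [x [y [x1 y1 big]]]]]]] := hump (n.+2%:R / c).
    by rewrite divr_ge0// ltW.
  pose L (m : S -> T -> R[i]) := mxform E G (schur_product Phi m) x y.
  have LE (m : S -> T -> R[i]) e : L (fun s t => m s t + e * b s t) = L m + e * L b.
    rewrite /L -mxform_lin; congr mxform; apply/funext => s; apply/funext => t.
    by rewrite /schur_product; ring.
  (* the two signs give values whose difference is large *)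
  have [e [e1 Le]] : exists e : R[i], rnorm e = c /\
      n.+2%:R < rnorm (L (fun s t => a s t + e * b s t)).
    have cL : n.+2%:R < rnorm (c%:C * L b).
      by rewrite rnormM rnorm_real gtr0_norm// mulrC -ltr_pdivrMr.
    have [small|] := leP (rnorm (L (fun s t => a s t + c%:C * b s t))) n.+2%:R;
      last by exists c%:C; rewrite rnorm_real gtr0_norm.
    exists (- c%:C); rewrite rnormN rnorm_real gtr0_norm//; split=> //.
    move: small cL; rewrite !LE mulNr; set u := L a; set v := _ * L b.
    have := rnormB_le (u + v) (u - v); have -> : u + v - (u - v) = 2%:C * v by ring.
    rewrite rnormM rnorm_real; have -> : `|2 : R| = 2 by rewrite normr_nat.
    lra.
  (* the form of a matrix with entries at most r has modulus at most r * B *)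
  pose B := \sum_(s <- E) \sum_(t <- G) rnorm (Phi s t) * (rnorm (x t) * rnorm (y s)).
  have B0 : 0 <= B.
    by do 2 (apply: sumr_ge0 => ? _); rewrite !mulr_ge0 ?rnorm_ge0.
  have B1 : 0 < 2 * (1 + B) by lra.
  exists (fun s t => a s t + e * b s t, c / (2 * (1 + B))); split=> /=.
  - exact: divr_gt0.
  - by rewrite ler_pM2l// lef_pV2 ?posrE//; lra.
  - have := mxform_le_scale (ltW c0) b1; rewrite mulr1 => -[_ bc].
    split=> [|E' G' x' y']; first exact: ltW.
    have := bc E' G' x' y'; congr (_ <= _).
    have -> : (fun s t => a s t + e * b s t - a s t) = (fun s t => e * b s t).
      by apply/funext => s; apply/funext => t; ring.
    by rewrite !mxform_scale !rnormM e1 rnorm_real gtr0_norm.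
  exists E, G, x, y; split=> // m mc; apply: le_trans (rnorm_sum _ _ _) _.
  apply: (@le_trans _ _ (\sum_(s <- E) \sum_(t <- G)
    (2 * (c / (2 * (1 + B)))) * (rnorm (Phi s t) * (rnorm (x t) * rnorm (y s))))).
    apply: ler_sum => s _; apply: le_trans (rnorm_sum _ _ _) _.
    apply: ler_sum => t _; rewrite /schur_product !rnormM.
    rewrite -[leLHS]mulrA [rnorm (Phi s t) * _]mulrC -[leLHS]mulrA.
    by rewrite ler_wpM2r ?mulr_ge0 ?rnorm_ge0//; exact: mc.
  under eq_bigr do rewrite -mulr_sumr.
  rewrite -mulr_sumr -/B.
  have -> : 2 * (c / (2 * (1 + B))) * B = c * (B / (1 + B)).
    by field; rewrite gt_eqF//; lra.
  by rewrite ler_piMr ?(ltW c0)// ler_pdivrMr; lra.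
have [f fP] : exists f, forall np : nat * ((S -> T -> R[i]) * R),
    0 < np.2.2 -> step np.1 np.2 (f np).
  suff /choice[f fP] : forall np : nat * ((S -> T -> R[i]) * R),
      exists q, 0 < np.2.2 -> step np.1 np.2 q by exists f.
  move=> -[n p] /=.
  have [p0|p0] := ltP 0 p.2; first by have [q qP] := stepP n p p0; exists q.
  by exists p.
pose st := fix st n := if n is n'.+1 then f (n', st n') else
  ((fun _ _ => 0, 1) : (S -> T -> R[i]) * R).
pose a n := (st n).1; pose c n := (st n).2.
have c0 n : 0 < c n by elim: n => [|n IH]; [exact: ltr01|case: (fP (n, st n) IH)].
have stP n : step n (st n) (st n.+1) by exact: (fP (n, st n) (c0 n)).
have cS n : c n.+1 <= c n / 2 by case: (stP n).
have cle1 n : c n <= 1.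
  by elim: n => [|n IH]; [exact: lexx|have := cS n; have := c0 n; lra].
have c_small (e : R) : 0 < e -> exists n, 2 * c n < e.
  move=> e0; have chalf n : c n * n.+1%:R <= 1.
    elim: n => [|n IH]; first by rewrite mulr1.
    have := cS n; have := c0 n.+1; have : 0 <= n%:R :> R by [].
    by move: IH; rewrite -(natr1 n) -(natr1 n.+1) -(natr1 n); nra.
  exists (Num.truncn (2 / e)); set N := Num.truncn _; have := truncnS_gt (2 / e).
  rewrite -/N ltr_pdivrMr// -(ltr_pM2r (c0 N)); have := chalf N.
  rewrite -(ler_pM2l e0); lra.
have aD n k : mxform_le (fun s t => a (n + k)%N s t - a n s t) (2 * (c n - c (n + k)%N)).
  elim: k => [|k IH].
    rewrite addn0 subrr mulr0; apply: mxform_le_unit => // E G x y _ _.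
    rewrite /mxform big1 ?rnorm0// => s _; rewrite big1// => t _.
    by rewrite subrr !mul0r.
  rewrite addnS; have [_ _ inc _] := stP (n + k)%N.
  have := mxform_leD 1 IH inc; rewrite rnorm1 mul1r => /mxform_leW.
  have -> : (fun s t => a (n + k)%N s t - a n s t +
      1 * ((st (n + k).+1).1 s t - (st (n + k)%N).1 s t)) =
      (fun s t => a (n + k).+1 s t - a n s t).
    by apply/funext => s; apply/funext => t; rewrite /a; ring.
  by apply; have := cS (n + k)%N; rewrite -/(c (n + k)%N); lra.
have a_entry n k s t : rnorm (a (n + k)%N s t - a n s t) <= 2 * c n.
  apply: le_trans (mxform_le_entry s t (aD n k)) _.
  by have := c0 (n + k)%N; lra.
have [al alP] : exists al : S -> T -> R[i], forall s t, a n s t @[n --> \oo] --> al s t.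
  suff /choice[al alP] : forall s, exists al : T -> R[i], forall t,
      a n s t @[n --> \oo] --> al t by exists al.
  move=> s; suff /choice[al alP] : forall t, exists l : R[i],
      a n s t @[n --> \oo] --> l by exists al.
  move=> t.
  apply: complex_cauchy_cvg => e e0.
  have [N Ne] := c_small e e0; exists (a N s t); exists N => // k /= Nk.
  by rewrite rnormBC -(subnKC Nk); apply: le_lt_trans (a_entry _ _ _ _) Ne.
have al_entry n s t : rnorm (al s t - a n s t) <= 2 * c n.
  have : a k s t - a n s t @[k --> \oo] --> al s t - a n s t.
    by apply: cvgB; [exact: alP|exact: cvg_cst].
  move/rnorm_lim_le; apply; exists n => // k /= nk.
  by rewrite -(subnKC nk) a_entry.
have al_le : mxform_le al 2.
  apply: mxform_le_unit => // E G x y x1 y1.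
  have : mxform E G (a n) x y @[n --> \oo] --> mxform E G al x y.
    apply: cvg_big => [z|s _]; first exact: add_continuous.
    apply: cvg_big => [z|t _]; first exact: add_continuous.
    by apply: cvgMl; apply: cvgMl; exact: alP.
  move/rnorm_lim_le; apply; apply: nearW => n.
  have [_] := aD 0 n; rewrite add0n => /(_ E G x y).
  have -> : (fun s t => a n s t - a 0 s t) = a n.
    by apply/funext => s; apply/funext => t; rewrite /a/= subr0.
  move=> /le_trans; apply; rewrite -[leRHS]mulr1 ler_pM ?mulr_ge0 ?l2fin_ge0//.
    by have := cle1 n; rewrite -/(c 0%N) {2}/c/=; lra.
  rewrite -[leRHS]mulr1 ler_pM ?l2fin_ge0//; have := cle1 n; have := c0 n.
    by rewrite {3}/c/=; lra.
  by rewrite {3}/c/=; lra.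
have [M [M0 PhiM]] := mx_bounded_mxform_le (Phi_mult _ (mxform_le_bounded al_le).1).
have [n Mn] : exists n : nat, M < n%:R.
  by exists (Num.truncn M).+1; rewrite truncnS_gt.
have [_ _ _ [E [G [x [y [x1 y1 big rest]]]]]] := stP n.
have := rest (fun s t => al s t - a n.+1 s t) (al_entry n.+1).
have -> : mxform E G (schur_product Phi (fun s t => al s t - a n.+1 s t)) x y =
    mxform E G (schur_product Phi al) x y - mxform E G (schur_product Phi (a n.+1)) x y.
  rewrite -mulN1r -mxform_lin; congr mxform; apply/funext => s; apply/funext => t.
  by rewrite /schur_product; ring.
have Mle : rnorm (mxform E G (schur_product Phi al) x y) <= M.
  apply: le_trans (PhiM _ _ _ _) _; rewrite -mulrA ler_piMr//.
  by rewrite mulr_ile1 ?l2fin_ge0.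
rewrite rnormBC; move: big; rewrite -/(a n.+1) -/(c n).
set u := mxform _ _ _ _ _; set v := mxform _ _ _ _ _ in Mle * => big uv.
have := rnormD_le (u - v) v; rewrite subrK; have := cle1 n; move: big Mn.
by rewrite -addn2 natrD; lra.
Qed.

End SchurBound.

(** * Euclidean spaces *)

(** A fresh name for the finite functions, which carries the Euclidean norm and
    its topology. *)
Definition eucl (R : realType) (I : finType) : Type := {ffun I -> (R[i])^o}.

Section EuclideanSpace.
Variables (R : realType) (I : finType).
Local Notation H := (eucl R I).

HB.instance Definition _ := GRing.Lmodule.on H.

Definition eucl_norm (x : H) : R[i] := (l2fin (index_enum I) x)%:C.

Lemma eucl_normD x y : eucl_norm (x + y) <= eucl_norm x + eucl_norm y.
Proof.
rewrite -rmorphD lecR; apply: le_trans (l2finD _ _ _).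
by rewrite le_eqVlt; apply/orP; left; apply/eqP/eq_l2fin => i _; rewrite ffunE.
Qed.

Lemma eucl_normZ c x : eucl_norm (c *: x) = `|c| * eucl_norm x.
Proof.
rewrite -rnormE -rmorphM/= -l2finZ; congr _%:C.
by apply: eq_l2fin => i _; rewrite ffunE.
Qed.

Lemma eucl_norm_eq0 x : eucl_norm x = 0 -> x = 0.
Proof.
move=> /(@complexI R) x0; apply/ffunP => i; rewrite ffunE.
by apply: rnorm_le0; rewrite -x0 le_l2fin// mem_index_enum.
Qed.

HB.instance Definition _ := Lmodule_isNormed.Build R[i] H
  eucl_normD eucl_normZ eucl_norm_eq0.

Lemma rnorm_eucl (x : H) : rnorm x = l2fin (index_enum I) x.
Proof. by []. Qed.

Lemma eucl_norm_le_sum (x : H) : rnorm x <= \sum_i rnorm (x i).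
Proof.
rewrite rnorm_eucl; apply: l2fin_dual => [|y].
  by apply: sumr_ge0 => i _; exact: rnorm_ge0.
apply: le_trans (rnorm_sum _ _ _) _; rewrite mulr_suml; apply: ler_sum => i _.
by rewrite rnormM ler_wpM2l ?rnorm_ge0// le_l2fin// mem_index_enum.
Qed.

Lemma eucl_coord_le (x : H) i : rnorm (x i) <= rnorm x.
Proof. exact: le_l2fin (mem_index_enum i). Qed.

Lemma eucl_cauchy_cvg (G : set_system H) (FF : ProperFilter G) : cauchy G -> cvg G.
Proof.
move=> /cauchyP Gc.
have coord i : exists l : R[i], (fun x : H => x i : R[i]) @ G --> l.
  apply: complex_cauchy_cvg => e e0.
  have [|z zG] := Gc e%:C; first by rewrite ltcR.
  exists (z i); move: zG; apply: filterS => x /=.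
  rewrite -ball_normE /ball_/= -rnormE ltcR; apply: le_lt_trans.
  by have := eucl_coord_le (z - x) i; rewrite !ffunE.
have /choice[l lP] := coord.
apply/cvg_ex; exists ([ffun i => l i] : H).
apply: (@rnorm_cvg _ H H G _ id) => e e0.
pose d := e / #|I|.+1%:R.
have d0 : 0 < d by rewrite divr_gt0.
have : \forall x \near G, forall i, rnorm (l i - (x : H) i) < d.
  by apply: filter_forall => i; exact: (cvg_rnormP _ _).1 (lP i) d d0.
apply: filterS => x xd; apply: le_lt_trans (eucl_norm_le_sum _) _.
apply: (@le_lt_trans _ _ (\sum_(i : I) d)).
  by apply: ler_sum => i _; have := ltW (xd i); rewrite !ffunE.
rewrite sumr_const -mulr_natr /d -mulrA gtr_pMr// mulrC ltr_pdivrMr// mul1r.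
by rewrite ltr_nat.
Qed.

HB.instance Definition _ := Uniform_isComplete.Build H eucl_cauchy_cvg.

Definition eucl_dot (x y : H) : R[i] := \sum_i x i * (y i)^*.

Lemma eucl_dot_bilinear : bilinear_for
  ( *%R : GRing.Scale.law R[i] R[i]) (Num.conj \; *%R : GRing.Scale.law R[i] R[i]) eucl_dot.
Proof.
split=> u a x y; rewrite /eucl_dot /= mulr_sumr -big_split/=; apply: eq_bigr => i _.
  by rewrite !ffunE mulrDl -mulrA.
by rewrite !ffunE rmorphD rmorphM/= mulrDr mulrCA.
Qed.

HB.instance Definition _ := bilinear_isBilinear.Build R[i] H H R[i] _ _ eucl_dot
  eucl_dot_bilinear.

Lemma eucl_dot_hermitian x y : eucl_dot x y = (-1) ^+ false * Num.conj (eucl_dot y x).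
Proof.
rewrite expr0 mul1r rmorph_sum/=; apply: eq_bigr => i _.
by rewrite rmorphM/= conjCK mulrC.
Qed.

HB.instance Definition _ := isHermitianSesquilinear.Build R[i] H false _ eucl_dot
  eucl_dot_hermitian.

Lemma eucl_dot_norm (x : H) : `|x| ^+ 2 = eucl_dot x x.
Proof.
rewrite -rnormE -rmorphXn/= rnorm_eucl sqr_l2fin rmorph_sum/=.
by apply: eq_bigr => i _; rewrite mulC_conj.
Qed.

Lemma eucl_dot_gt0 (x : H) : x != 0 -> 0 < eucl_dot x x.
Proof. by move=> x0; rewrite -eucl_dot_norm exprn_gt0// normr_gt0. Qed.

HB.instance Definition _ := isDotProduct.Build R[i] H eucl_dot eucl_dot_gt0.

Definition eucl_hilbert : hilbertSpace R :=
  @HilbertSpace R H (eucl_dot : {dot H for Num.conj}) eucl_dot_norm.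

End EuclideanSpace.

(** * Operator norms and diagonal operators *)

Section OperatorNorm.
Variables (R : realType) (H : hilbertSpace R).
Implicit Types (T : H -> H) (x : H) (M : R).

Lemma linear_op0 T : linear T -> T 0 = 0.
Proof. by move=> Tl; rewrite -[X in T X](scaler0 _ (-1)) -[_ *: _]addr0 Tl scaleN1r addNr. Qed.

Lemma linear_opD T x y : linear T -> T (x + y) = T x + T y.
Proof. by move=> /(_ 1 x y); rewrite !scale1r. Qed.

Lemma linear_opZ T c x : linear T -> T (c *: x) = c *: T x.
Proof. by move=> Tl; rewrite -[c *: x]addr0 Tl linear_op0// addr0. Qed.

Lemma linear_opB T x y : linear T -> T (x - y) = T x - T y.
Proof. by move=> Tl; rewrite linear_opD// -scaleN1r linear_opZ// scaleN1r. Qed.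

Lemma linear_op_sum T (I : Type) (r : seq I) (P : pred I) (u : I -> H) : linear T ->
  T (\sum_(i <- r | P i) u i) = \sum_(i <- r | P i) T (u i).
Proof.
move=> Tl; elim/big_rec2 : _ => [|i v w _ <-]; first exact: linear_op0.
exact: linear_opD.
Qed.

Lemma opnorm_le T M : 0 <= M -> (forall x, rnorm (T x) <= M * rnorm x) ->
  (opnorm T <= M%:E)%E.
Proof.
move=> M0 TM; apply: ge_ereal_sup => _ [x /= x1 <-]; rewrite lee_fin.
by apply: le_trans (TM x) _; rewrite ler_piMr.
Qed.

Lemma le_opnorm T M : linear T -> (opnorm T <= M%:E)%E ->
  forall x, rnorm (T x) <= M * rnorm x.
Proof.
move=> Tl TM x; have [x0|x0] := eqVneq (rnorm x) 0.
  by rewrite (rnorm_eq0 x0) linear_op0// !rnorm0 mulr0.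
have xgt0 : 0 < rnorm x by rewrite lt_neqAle eq_sym x0 rnorm_ge0.
have : ((rnorm (T ((rnorm x)^-1%:C *: x)))%:E <= M%:E)%E.
  apply: le_trans TM; apply: ereal_sup_ubound; exists ((rnorm x)^-1%:C *: x) => //=.
  by rewrite rnormZ rnorm_real gtr0_norm ?invr_gt0// mulVf.
rewrite lee_fin linear_opZ// rnormZ rnorm_real gtr0_norm ?invr_gt0//.
by rewrite mulrC ler_pdivrMr.
Qed.

Lemma bounded_op_ge0 T : bounded_op T ->
  exists2 M : R, 0 <= M & forall x, rnorm (T x) <= M * rnorm x.
Proof.
move=> [_ [M TM]]; exists `|M| => // x; apply: le_trans (TM x) _.
by rewrite ler_wpM2r ?rnorm_ge0// ler_norm.
Qed.

Lemma commutator_bounded T T' : bounded_op T -> bounded_op T' ->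
  bounded_op (commutator T T').
Proof.
move=> bT bT'; have [M M0 TM] := bounded_op_ge0 bT.
have [M' M'0 TM'] := bounded_op_ge0 bT'.
split.
  move=> c x y; rewrite /commutator !bT.1 !bT'.1 bT.1 scalerBr opprD !addrA.
  by congr (_ - _); rewrite addrAC.
exists (M * M' + M' * M) => x; apply: le_trans (rnormB_le _ _) _.
rewrite mulrDl; apply: lerD.
  by apply: le_trans (TM _) _; rewrite -mulrA ler_wpM2l.
by apply: le_trans (TM' _) _; rewrite -mulrA ler_wpM2l.
Qed.

Lemma opnorm_bounded T : bounded_op T ->
  exists2 L : R, 0 <= L & opnorm T = L%:E.
Proof.
move=> bT; have [M M0 TM] := bounded_op_ge0 bT.
have Tle := opnorm_le M0 TM.
have T0 : (0%:E <= opnorm T)%E.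
  apply: ereal_sup_ubound; exists 0 => /=; first by rewrite rnorm0.
  by rewrite (linear_op0 bT.1) rnorm0.
have Tfin : opnorm T \is a fin_num by rewrite ge0_fin_numE// (le_lt_trans Tle) ?ltry.
by exists (fine (opnorm T)); [rewrite fine_ge0|rewrite fineK].
Qed.

End OperatorNorm.

Section DiagonalOperators.
Variables (R : realType) (I : finType).
Local Notation H := (eucl_hilbert R I).
Implicit Types (d : I -> R[i]) (b : I -> I -> R[i]) (x : H).

Definition diag_op d : H -> H := fun x => [ffun i => d i * (x : eucl R I) i].

Definition mx_op b : H -> H := fun x => [ffun p => \sum_q b p q * (x : eucl R I) q].

Lemma diag_op_le d (m : R) : 0 <= m -> (forall i, rnorm (d i) <= m) ->
  forall x, rnorm (diag_op d x) <= m * rnorm x.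
Proof.
move=> m0 dm x; rewrite [leLHS]rnorm_eucl [rnorm x]rnorm_eucl.
rewrite -[m]ger0_norm// -rnorm_real -l2finZ ler_sqrt ?sum_sqr_ge0//.
apply: ler_sum => i _; rewrite ffunE !rnormM rnorm_real ger0_norm//.
by rewrite ler_pXn2r ?nnegrE ?mulr_ge0 ?rnorm_ge0// ler_wpM2r ?rnorm_ge0.
Qed.

Lemma diag_op_bounded d : bounded_op (diag_op d).
Proof.
split=> [c x y|].
  by apply/ffunP => i; rewrite !ffunE mulrDr mulrCA.
exists (\sum_i rnorm (d i)); apply: diag_op_le => [|i].
  by apply: sumr_ge0 => i _; exact: rnorm_ge0.
by rewrite (bigD1 i)//= lerDl sumr_ge0// => j _; exact: rnorm_ge0.
Qed.

Lemma mx_op_bounded b : bounded_op (mx_op b).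
Proof.
split=> [c x y|].
  apply/ffunP => p; rewrite !ffunE scaler_sumr -big_split/=.
  by apply: eq_bigr => q _; rewrite !ffunE mulrDr mulrCA.
exists (\sum_p \sum_q rnorm (b p q)) => x.
apply: le_trans (eucl_norm_le_sum _) _; rewrite mulr_suml; apply: ler_sum => p _.
rewrite ffunE; apply: le_trans (rnorm_sum _ _ _) _; rewrite mulr_suml.
by apply: ler_sum => q _; rewrite rnormM ler_wpM2l ?rnorm_ge0// eucl_coord_le.
Qed.

Lemma commutator_diag_mx d b :
  commutator (diag_op d) (mx_op b) = mx_op (fun p q => (d p - d q) * b p q).
Proof.
apply/funext => x; apply/ffunP => p; rewrite !ffunE mulr_sumr -sumrB.
by apply: eq_bigr => q _; rewrite !ffunE; ring.
Qed.

Lemma diag_op_adjoint d : is_adjoint (diag_op d) (diag_op (fun i => (d i)^*)).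
Proof.
move=> x y; apply: eq_bigr => i _; rewrite !ffunE.
by rewrite rmorphM/= conjCK; ring.
Qed.

Lemma diag_op_normal d : normal_op (diag_op d).
Proof.
exists (diag_op (fun i => (d i)^*)); split; [exact: diag_op_bounded|
  exact: diag_op_adjoint|move=> x].
by apply/ffunP => i; rewrite !ffunE mulrCA.
Qed.

(** If l is not among the entries d i, the diagonal operator of the inverses of
    the d i - l inverts; otherwise a basis vector is in the kernel. *)
Lemma spectrum_diag_op d : spectrum (diag_op d) = range d.
Proof.
apply/seteqP; split=> [l spl|_ [i _ <-] [S [[Sl _] S1 _]]].
  apply: contrapT => ld; apply: spl.
  have dl i : d i - l != 0 by rewrite subr_eq0; apply/eqP => di; apply: ld; exists i.
  exists (diag_op (fun i => (d i - l)^-1)); split; first exact: diag_op_bounded.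
    by move=> x; apply/ffunP => i; rewrite !ffunE -mulrBl mulKf.
  by move=> x; apply/ffunP => i; rewrite !ffunE -mulrBl mulVKf.
pose e : H := ([ffun j => if j == i then 1 else 0] : eucl R I).
have := S1 e; have -> : diag_op d e - d i *: e = 0.
  apply/ffunP => j; rewrite !ffunE; case: eqVneq => [->|_].
    exact: (subrr (d i * 1)).
  by rewrite mulr0 scaler0 subrr.
rewrite linear_op0// => /ffunP/(_ i); rewrite !ffunE eqxx => /eqP.
by rewrite eq_sym oner_eq0.
Qed.

Lemma diag_op_functional_calculus d :
  is_functional_calculus (diag_op d) (fun g => diag_op (g \o d)).
Proof.
split=> //.
- by move=> g _; exact: diag_op_bounded.
- by move=> g h _ _ x; apply/ffunP => i; rewrite !ffunE mulrDl.
- by move=> c g _ x; apply/ffunP => i; rewrite !ffunE; apply/esym/mulrA.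
- by move=> g h _ _ x; apply/ffunP => i; rewrite !ffunE mulrA.
- by move=> x; apply/ffunP => i; rewrite !ffunE mul1r.
- by move=> g _; exact: diag_op_adjoint.
- move=> g M _ M0 gM x; apply: diag_op_le => // i.
  by apply: gM; rewrite spectrum_diag_op; exists i.
Qed.

(** Applying the commutator inequality to the diagonal operator with entries
    z p and to the matrix with entries a p q / (z p - z q) bounds the Schur
    product of a with the divided differences. *)
Lemma CL_bound_finite (F : set R[i]) (f : R[i] -> R[i]) (K M : R) (z : I -> R[i])
    (a : I -> I -> R[i]) :
  0 <= K -> 0 <= M -> CL_bound F f K -> (forall i, F (z i)) ->
  (forall p q, z p = z q -> a p q = 0) ->
  (forall x y : I -> R[i], rnorm (\sum_p \sum_q a p q * x q * y p) <=
    M * l2fin (index_enum I) x * l2fin (index_enum I) y) ->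
  forall x y : I -> R[i],
    rnorm (\sum_p \sum_q (f (z p) - f (z q)) / (z p - z q) * a p q * x q * y p) <=
    K * M * l2fin (index_enum I) x * l2fin (index_enum I) y.
Proof.
move=> K0 M0 fK zF az aM x y; pose N := diag_op z.
pose B := mx_op (fun p q => a p q / (z p - z q)).
have specN : spectrum N `<=` F.
  by rewrite spectrum_diag_op => _ [i _ <-]; exact: zF.
have fN : is_fun_of_op f N (diag_op (f \o z)).
  by exists (fun g => diag_op (g \o z)) => //; exact: diag_op_functional_calculus.
have := fK H N B _ (diag_op_bounded z) (diag_op_normal z) specN (mx_op_bounded _) fN.
rewrite !commutator_diag_mx.
have -> : (fun p q => (z p - z q) * (a p q / (z p - z q))) = a.
  apply/funext => p; apply/funext => q.
  have [zpq|zpq] := eqVneq (z p - z q) 0; last by rewrite mulrC divfK.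
  by rewrite zpq mul0r az//; apply/eqP; rewrite -subr_eq0 zpq.
have aM' : (opnorm (mx_op a) <= M%:E)%E.
  apply: opnorm_le => // u; rewrite [rnorm u]rnorm_eucl rnorm_eucl.
  apply: l2fin_dual => [|v]; first by rewrite mulr_ge0 ?l2fin_ge0.
  have := aM u v; congr (_ <= _); congr rnorm; apply: eq_bigr => p _.
  by rewrite ffunE mulr_suml.
move=> fNB; have {fNB aM'} := le_trans fNB (lee_wpmul2l _ aM').
rewrite lee_fin K0 -EFinM => /(_ isT) /le_opnorm => /(_ (mx_op_bounded _).1).
move=> /(_ ([ffun q => x q] : eucl R I)); set Tx := mx_op _ _ => TxM.
have -> : \sum_p \sum_q (f (z p) - f (z q)) / (z p - z q) * a p q * x q * y p =
    \sum_p (Tx : eucl R I) p * y p.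
  apply: eq_bigr => p _; rewrite ffunE mulr_suml; apply: eq_bigr => q _.
  by rewrite ffunE/=; ring.
apply: le_trans (cauchy_schwarz_l2fin _ _ _) _; rewrite ler_wpM2r ?l2fin_ge0//.
apply: le_trans TxM _; rewrite rnorm_eucl ler_wpM2l ?mulr_ge0//.
by rewrite le_eqVlt; apply/orP; left; apply/eqP/eq_l2fin => q _; rewrite ffunE.
Qed.

End DiagonalOperators.

(** * Divided differences at finitely many points *)

Section DividedDifferenceMatrices.
Variables (R : realType) (F : set R[i]) (f : R[i] -> R[i]) (K : R).
Hypotheses (K0 : 0 <= K) (fK : CL_bound F f K).

(** The operators of [CL_bound_finite] act on the sum of the two index types,
    where the matrix a is an off-diagonal block; the condition put there on the
    matrix then says that the two families of points are disjoint. *)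
Lemma CL_bound_rect (J L : finType) (s : J -> R[i]) (t : L -> R[i])
    (a : J -> L -> R[i]) (M : R) : 0 <= M ->
  (forall j, F (s j)) -> (forall l, F (t l)) -> (forall j l, s j != t l) ->
  (forall x y, rnorm (\sum_j \sum_l a j l * x l * y j) <=
    M * l2fin (index_enum L) x * l2fin (index_enum J) y) ->
  forall x y, rnorm (\sum_j \sum_l (f (s j) - f (t l)) / (s j - t l) * a j l * x l * y j)
    <= K * M * l2fin (index_enum L) x * l2fin (index_enum J) y.
Proof.
move=> M0 sF tF st aM x y.
pose z (p : J + L) := match p with inl j => s j | inr l => t l end.
pose a' (p q : J + L) := match p, q with inl j, inr l => a j l | _, _ => 0 end.
have form_block (g : J + L -> J + L -> R[i]) (x' y' : J + L -> R[i]) :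
    \sum_p \sum_q g p q * a' p q * x' q * y' p =
    \sum_j \sum_l g (inl j) (inr l) * a j l * x' (inr l) * y' (inl j).
  rewrite big_sumType/= [X in _ + X]big1 ?addr0 => [|l _]; last first.
    by rewrite big1// => q _; rewrite mulr0 !mul0r.
  apply: eq_bigr => j _; rewrite big_sumType/= big1 ?add0r// => i _.
  by rewrite mulr0 !mul0r.
have zF p : F (z p) by case: p.
have a'0 p q : z p = z q -> a' p q = 0.
  by case: p q => [j|l] [j'|l'] //= jl; have := st j l'; rewrite jl eqxx.
have a'M (x' y' : J + L -> R[i]) : rnorm (\sum_p \sum_q a' p q * x' q * y' p) <=
    M * l2fin (index_enum (J + L)%type) x' * l2fin (index_enum (J + L)%type) y'.
  have := form_block (fun _ _ => 1) x' y'.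
  under eq_bigr do under eq_bigr do rewrite mul1r.
  under [in RHS]eq_bigr do under eq_bigr do rewrite mul1r.
  move=> ->; apply: le_trans (aM _ _) _.
  rewrite ler_pM ?mulr_ge0 ?l2fin_ge0// ?ler_wpM2l// ler_sqrt ?sum_sqr_ge0//.
    by rewrite [leRHS]big_sumType lerDr sum_sqr_ge0.
  by rewrite [leRHS]big_sumType lerDl sum_sqr_ge0.
pose x' (p : J + L) := match p with inl _ => 0 | inr l => x l end.
pose y' (p : J + L) := match p with inl j => y j | inr _ => 0 end.
have := CL_bound_finite K0 M0 fK zF a'0 a'M x' y'.
rewrite (form_block (fun p q => (f (z p) - f (z q)) / (z p - z q))) => /le_trans; apply.
rewrite le_eqVlt; apply/orP; left; apply/eqP; congr (_ * _ * _).
  rewrite /l2fin big_sumType/= [X in X + _]big1 ?add0r// => i _.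
  by rewrite rnorm0 expr0n.
rewrite /l2fin big_sumType/= [X in _ + X]big1 ?addr0// => i _.
by rewrite rnorm0 expr0n.
Qed.

Lemma CL_bound_lipschitz s t : F s -> F t -> rnorm (f s - f t) <= K * rnorm (s - t).
Proof.
move=> sF tF; have [->|st] := eqVneq s t; first by rewrite !subrr !rnorm0 mulr0.
have one (x y : unit -> R[i]) : rnorm (\sum_j \sum_l 1 * x l * y j) <=
    1 * l2fin (index_enum unit) x * l2fin (index_enum unit) y.
  rewrite mul1r mulrC exchange_big/=; under eq_bigr do under eq_bigr do rewrite mul1r.
  have u (F' : unit -> R[i]) : \sum_i F' i = F' tt.
    by rewrite (bigD1 tt)//= big1 ?addr0// => -[].
  rewrite !u rnormM mulrC.
  by apply: ler_pM; rewrite ?rnorm_ge0 ?le_l2fin ?mem_index_enum.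
have := @CL_bound_rect unit unit (fun=> s) (fun=> t) (fun _ _ => 1) 1 ler01
  (fun=> sF) (fun=> tF) (fun _ _ => st) one (fun=> 1) (fun=> 1).
rewrite /l2fin !sumr_const !card_unit !mulr1n !mulr1 rnorm1 expr1n sqrtr1 !mulr1.
have st0 : 0 < rnorm (s - t).
  by rewrite lt_neqAle rnorm_ge0 andbT eq_sym; apply: contra_neq st => /rnorm_eq0/subr0_eq.
by rewrite rnormM rnormV ler_pdivrMr.
Qed.

Lemma CL_bound_divided_difference_le s t : F s -> F t ->
  rnorm ((f s - f t) / (s - t)) <= K.
Proof.
move=> sF tF; have [->|st] := eqVneq s t; first by rewrite subrr mul0r rnorm0.
have st0 : 0 < rnorm (s - t).
  by rewrite lt_neqAle rnorm_ge0 andbT eq_sym; apply: contra_neq st => /rnorm_eq0/subr0_eq.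
by rewrite rnormM rnormV ler_pdivrMr// CL_bound_lipschitz.
Qed.

End DividedDifferenceMatrices.

(** * Haar matrices and triangular truncation *)

Section HaarMatrix.
Variable R : realType.

(** A matrix of order 2 ^ k whose norm is at most sqrt k, while its part below
    the diagonal has entries of sum - k 2 ^ k / 4: the truncation to that part
    multiplies the norm by at least sqrt k / 4. It maps a vector to the sum,
    over the dyadic intervals of length at least 2, of the mean on the interval
    times its Haar function. *)
Fixpoint haar_mx (k : nat) (i j : nat) : R :=
  if k is k'.+1 then let N := (2 ^ k')%N in
    (if (i < N)%N && (j < N)%N then haar_mx k' i j
     else if (N <= i)%N && (N <= j)%N then haar_mx k' (i - N) (j - N) else 0)
    + (if (i < N)%N then 1 else -1) / (2 * N)%:R
  else 0.

Lemma sum_pow2S (V : nmodType) k (F : nat -> V) :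
  \sum_(i < 2 ^ k.+1) F i = \sum_(i < 2 ^ k) F i + \sum_(i < 2 ^ k) F (2 ^ k + i)%N.
Proof. by rewrite expnS mul2n -addnn big_split_ord. Qed.

Lemma haar_mx_ll k i j : (i < 2 ^ k)%N -> (j < 2 ^ k)%N ->
  haar_mx k.+1 i j = haar_mx k i j + (2 * 2 ^ k)%:R^-1.
Proof. by move=> iN jN /=; rewrite iN jN /= div1r. Qed.

Lemma haar_mx_lr k i j : (i < 2 ^ k)%N ->
  haar_mx k.+1 i (2 ^ k + j)%N = (2 * 2 ^ k)%:R^-1.
Proof. by move=> iN /=; rewrite iN ltnNge leq_addr /= leqNgt iN/= add0r div1r. Qed.

Lemma haar_mx_rl k i j : (j < 2 ^ k)%N ->
  haar_mx k.+1 (2 ^ k + i)%N j = - (2 * 2 ^ k)%:R^-1.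
Proof.
by move=> jN /=; rewrite ltnNge leq_addr /= leqNgt jN/= add0r mulN1r.
Qed.

Lemma haar_mx_rr k i j :
  haar_mx k.+1 (2 ^ k + i)%N (2 ^ k + j)%N = haar_mx k i j - (2 * 2 ^ k)%:R^-1.
Proof. by rewrite /= ltnNge leq_addr /= leq_addr/= !addKn mulN1r. Qed.

Arguments haar_mx : simpl never.

Lemma haar_mx_column k j : (j < 2 ^ k)%N -> \sum_(i < 2 ^ k) haar_mx k i j = 0.
Proof.
elim: k j => [|k IH] j; first by rewrite big1.
move=> jk; rewrite (sum_pow2S k (fun i => haar_mx k.+1 i j)); have [jN|jN] := ltnP j (2 ^ k).
  under eq_bigr do rewrite haar_mx_ll//.
  under [X in _ + X]eq_bigr do rewrite haar_mx_rl//.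
  by rewrite big_split/= IH// add0r sumrN subrr.
have -> : j = (2 ^ k + (j - 2 ^ k))%N by rewrite subnKC.
under eq_bigr do rewrite haar_mx_lr//.
under [X in _ + X]eq_bigr do rewrite haar_mx_rr.
rewrite sumrB/= IH ?sub0r ?subrr//.
by rewrite ltn_subLR// addnn -mul2n -expnS.
Qed.

Lemma haar_mx_apply k (x : nat -> R) :
  \sum_(i < 2 ^ k) (\sum_(j < 2 ^ k) haar_mx k i j * x j) = 0.
Proof.
rewrite exchange_big/= big1// => j _.
by rewrite -mulr_suml haar_mx_column ?mul0r.
Qed.

Lemma sum_shift_sqr n (h : 'I_n -> R) (c : R) : \sum_i h i = 0 ->
  \sum_i (h i + c) ^+ 2 = \sum_i h i ^+ 2 + n%:R * c ^+ 2.
Proof.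
move=> h0; under eq_bigr do rewrite sqrrD.
rewrite !big_split/= -addrA [X in _ + (X + _)](_ : _ = 0) ?add0r.
  by rewrite sumr_const card_ord mulr_natl.
by rewrite -mulr_suml h0 mul0r addr0.
Qed.

(** One level adds c on the left half and - c on the right half, where c is the
    mean of x, to vectors of sum 0: the squared norms add up, and the new part
    2 N c ^ 2 is at most the squared norm of x. *)
Lemma haar_mx_norm k (x : nat -> R) :
  \sum_(i < 2 ^ k) (\sum_(j < 2 ^ k) haar_mx k i j * x j) ^+ 2 <=
  k%:R * \sum_(j < 2 ^ k) x j ^+ 2.
Proof.
elim: k x => [|k IH] x.
  by rewrite mul0r big1// => i _; rewrite big1 ?expr0n// => j _; rewrite mul0r.
set N := (2 ^ k)%N; pose S := \sum_(j < 2 ^ k.+1) x j; pose c := S / (2 * N)%:R.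
have N0 : (2 * N)%:R != 0 :> R by rewrite pnatr_eq0 muln_eq0 expn_eq0.
pose x' j := x (N + j)%N.
have SE : S = \sum_(j < N) x j + \sum_(j < N) x' j by exact: sum_pow2S.
pose h y (i : nat) := \sum_(j < N) haar_mx k i j * y j.
have hl (i : 'I_N) : \sum_(j < 2 ^ k.+1) haar_mx k.+1 i j * x j = h x i + c.
  rewrite (sum_pow2S k (fun j => haar_mx k.+1 i j * x j)).
  under eq_bigr do rewrite haar_mx_ll// mulrDl.
  under [X in _ + X]eq_bigr do rewrite haar_mx_lr//.
  by rewrite big_split/= -!mulr_sumr -addrA -mulrDr -SE mulrC.
have hr (i : 'I_N) : \sum_(j < 2 ^ k.+1) haar_mx k.+1 (N + i)%N j * x j = h x' i - c.
  rewrite (sum_pow2S k (fun j => haar_mx k.+1 (N + i)%N j * x j)).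
  under eq_bigr do rewrite haar_mx_rl//.
  under [X in _ + X]eq_bigr do rewrite haar_mx_rr mulrBl.
  rewrite sumrB/= -!mulr_sumr mulNr addrCA; congr (_ + _).
  by rewrite -opprD -mulrDr -SE mulrC.
rewrite (sum_pow2S k (fun i => (\sum_(j < 2 ^ k.+1) haar_mx k.+1 i j * x j) ^+ 2)).
under eq_bigr do rewrite hl.
under [X in _ + X]eq_bigr do rewrite hr.
rewrite !sum_shift_sqr ?haar_mx_apply// sqrrN.
rewrite (sum_pow2S k (fun j => x j ^+ 2)).
have cS : N%:R * c ^+ 2 + N%:R * c ^+ 2 <= \sum_(j < N) x j ^+ 2 + \sum_(j < N) x' j ^+ 2.
  have := cauchy_schwarz_sqr (index_enum 'I_(2 ^ k.+1)) (fun=> 1) (fun j => x j).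
  under eq_bigr do rewrite mul1r.
  under [X in _ <= X * _]eq_bigr do rewrite expr1n.
  rewrite sumr_const card_ord (sum_pow2S k (fun j => x j ^+ 2)) -/S -/N.
  have -> : S = c * (2 * N)%:R by rewrite divfK.
  have N1 : 0 < (2 * N)%:R :> R by rewrite lt_neqAle eq_sym N0 ler0n.
  rewrite expnS -/N exprMn expr2 [X in _ * X <= _]expr2 mulrA [leRHS]mulrC.
  rewrite ler_pM2r// natrM; set X := _ + _; lra.
have := IH x; have := IH x'; rewrite -/N -(natr1 k) => h1 h2.
rewrite /h; move: cS h1 h2; rewrite /x'; lra.
Qed.

(** The constants added to the two diagonal blocks are opposite and cancel; the
    lower left block, of N ^ 2 entries - 1 / (2 N), contributes - N / 2. *)
Lemma haar_mx_lower k :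
  \sum_(i < 2 ^ k) \sum_(j < 2 ^ k) (j < i)%:R * haar_mx k i j =
  - (k%:R * (2 ^ k)%:R / 4).
Proof.
elim: k => [|k IH].
  by rewrite !mul0r oppr0 big1// => i _; rewrite big1// => j _; rewrite mulr0.
set N := (2 ^ k)%N; pose u : R := (2 * N)%:R^-1.
pose C := \sum_(i < N) \sum_(j < N) (j < i)%:R : R.
have N0 : N%:R != 0 :> R by rewrite pnatr_eq0 expn_eq0.
rewrite (sum_pow2S k (fun i => \sum_(j < 2 ^ k.+1) (j < i)%:R * haar_mx k.+1 i j)).
rewrite (_ : \sum_(i < N) _ = - (k%:R * N%:R / 4) + C * u); last first.
  rewrite -IH mulr_suml -big_split/=; apply: eq_bigr => i _.
  rewrite (sum_pow2S k (fun j => (j < i)%:R * haar_mx k.+1 i j)).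
  rewrite [X in _ + X]big1 ?addr0 => [|j _]; last first.
    by rewrite ltnNge (leq_trans (ltnW (ltn_ord i)) (leq_addr _ _)) mul0r.
  rewrite mulr_suml -big_split/=; apply: eq_bigr => j _.
  by rewrite haar_mx_ll// mulrDr.
rewrite (_ : \sum_(i < 2 ^ k) _ = - (k%:R * N%:R / 4) - C * u - N%:R / 2); last first.
  rewrite -IH.
  have -> : N%:R / 2 = \sum_(i < N) N%:R * u.
    by rewrite sumr_const card_ord -mulr_natl /u natrM; field.
  rewrite mulr_suml -!sumrB; apply: eq_bigr => i _.
  rewrite (sum_pow2S k (fun j => (j < N + i)%:R * haar_mx k.+1 (N + i)%N j)).
  rewrite (_ : \sum_(j < N) _ = - (N%:R * u)); last first.
    rewrite -[N in N%:R]card_ord -sumr_const mulr_suml -sumrN.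
    apply: eq_bigr => j _; rewrite haar_mx_rl//.
    by rewrite (leq_trans (ltn_ord j) (leq_addr _ _)) !mul1r.
  rewrite addrC; congr (_ - _); rewrite mulr_suml -sumrB; apply: eq_bigr => j _.
  by rewrite haar_mx_rr ltn_add2l mulrBr.
by rewrite expnS -/N natrM -(natr1 k); field.
Qed.

(** For a real matrix, the real and the imaginary parts of the image are the
    images of those parts. *)
Lemma haar_mx_form k (x y : 'I_(2 ^ k) -> R[i]) :
  rnorm (\sum_(i < 2 ^ k) \sum_(j < 2 ^ k) (haar_mx k i j)%:C * x j * y i) <=
  Num.sqrt k%:R * l2fin (index_enum _) x * l2fin (index_enum _) y.
Proof.
under eq_bigr do rewrite -mulr_suml.
apply: le_trans (cauchy_schwarz_l2fin _ _ _) _; rewrite ler_wpM2r ?l2fin_ge0//.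
rewrite /l2fin -sqrtrM ?ler0n// ler_sqrt ?mulr_ge0 ?ler0n ?sum_sqr_ge0//.
pose ext (u : 'I_(2 ^ k) -> R) (j : nat) := oapp u 0 (insub j).
have extE u (j : 'I_(2 ^ k)) : ext u j = u j by rewrite /ext valK.
have re := haar_mx_norm k (ext (fun j => complex.Re (x j))).
have im := haar_mx_norm k (ext (fun j => complex.Im (x j))).
have sqrE u : \sum_(j < 2 ^ k) ext u j ^+ 2 = \sum_(j < 2 ^ k) u j ^+ 2.
  by apply: eq_bigr => j _; rewrite extE.
rewrite !sqrE in re im.
under [X in _ <= _ * X]eq_bigr do rewrite rnorm_sqr.
rewrite big_split/= mulrDr; apply: le_trans (lerD re im).
rewrite -big_split/= le_eqVlt; apply/orP; left; apply/eqP; apply: eq_bigr => i _.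
rewrite rnorm_sqr !raddf_sum/=; congr (_ ^+ 2 + _ ^+ 2); apply: eq_bigr => j _.
  by rewrite extE; case: (x j) => a b /=; ring.
by rewrite extE; case: (x j) => a b /=; ring.
Qed.

End HaarMatrix.

(** * Cluster points of bounded functions *)

Section TwoClusterPoints.
Variable R : realType.

Lemma complex_box_compact (c : R) :
  compact [set z : R[i] | `|complex.Re z| <= c /\ `|complex.Im z| <= c].
Proof.
have -> : [set z : R[i] | `|complex.Re z| <= c /\ `|complex.Im z| <= c] =
    (fun p : R * R => p.1 +i* p.2) @` (`[- c, c] `*` `[- c, c]).
  apply/seteqP; split=> [[a b] /= []|_ [[a b] /= [ac bc] <-]] /=.
    by rewrite !ler_norml => ac bc; exists (a, b) => //; split; rewrite /= in_itv.
  by move: ac bc; rewrite !in_itv/= !ler_norml.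
apply: continuous_compact; last by apply: compact_setX; exact: segment_compact.
apply: continuous_subspaceT => -[a b]; apply: rnorm_cvg => e e0.
have e20 : 0 < e / 2 by rewrite divr_gt0.
have /cvgrPdist_lt/(_ _ e20) ca : (p : R * R).1 @[p --> (a, b)] --> a by exact: cvg_fst.
have /cvgrPdist_lt/(_ _ e20) cb : (p : R * R).2 @[p --> (a, b)] --> b by exact: cvg_snd.
near=> p; apply: le_lt_trans (rnorm_le_ReIm _) _; rewrite !raddfB/= (splitr e).
by apply: ltrD; near: p.
Unshelve. all: by end_near. Qed.

Lemma bounded_cluster (T : Type) (G : set_system T) {FF : ProperFilter G}
    (g : T -> R[i]) (c : R) : (\forall x \near G, rnorm (g x) <= c) ->
  exists l : R[i], forall A e, G A -> 0 < e -> exists2 x, A x & rnorm (l - g x) < e.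
Proof.
move=> gc; have [|l [_ lP]] := @complex_box_compact c (g @ G) _.
  apply: filterS gc => x xc /=.
  by split; [apply: le_trans (normr_Re_le _) xc|apply: le_trans (normr_Im_le _) xc].
exists l => A e GA e0.
have [||w [[x Ax <-] xe]] := lP (g @` A) [set w | rnorm (l - w) < e].
- by apply: (@filterS _ G _ A) GA => x Ax; exists x.
- by apply/nbhs_rnormP; exists e.
by exists x.
Qed.

(** Bounded values have a cluster point by compactness. If they do not converge
    to it, they stay off a ball around it along a finer filter, which gives a
    second cluster point. *)
Lemma bounded_not_cvg (T : Type) (G : set_system T) {FF : ProperFilter G}
    (g : T -> R[i]) (c : R) : (\forall x \near G, rnorm (g x) <= c) ->
  ~ cvg (g @ G) -> exists l : bool -> R[i], l true != l false /\
    forall b A e, G A -> 0 < e -> exists2 x, A x & rnorm (l b - g x) < e.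
Proof.
move=> gc gN; have [l1 l1P] := bounded_cluster gc.
have [e e0 eN] : exists2 e : R, 0 < e & ~ \forall x \near G, rnorm (l1 - g x) < e.
  apply: contrapT => noe; apply: gN; apply/cvg_ex; exists l1; apply: rnorm_cvg => e e0.
  by apply: contrapT => eN; apply: noe; exists e.
pose D := [set x | ~ rnorm (l1 - g x) < e].
have FD : ProperFilter (within D G).
  apply: Build_ProperFilter_ex => B; rewrite /within/= => GB.
  apply: contrapT => B0; apply: eN; apply: filterS GB => x DB.
  by apply: contrapT => Dx; apply: B0; exists x; exact: DB.
have [l2 l2P] : exists l : R[i], forall A d, (within D G) A -> 0 < d ->
    exists2 x, A x & rnorm (l - g x) < d.
  by apply: (@bounded_cluster _ _ FD g c); apply: filterS gc => x xc _.
exists (fun b => if b then l1 else l2); split=> [|[] A d GA d0].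
- apply/eqP => l12; have [|x Dx] := l2P D e _ e0; first exact: withinT.
  by rewrite -l12.
- exact: l1P.
- by apply: l2P => //; apply: filterS GA.
Qed.

End TwoClusterPoints.

(** * Differentiability of commutator Lipschitz functions *)

Section Differentiability.
Variables (R : realType) (F : set R[i]) (f : R[i] -> R[i]) (K : R).
Hypotheses (F_perfect : perfect_set F) (K0 : 0 <= K) (fK : CL_bound F f K).

Lemma diff_quotientC z w : diff_quotient f z w = diff_quotient f w z.
Proof. by rewrite /diff_quotient -(opprB (f z)) -(opprB z) invrN mulrNN. Qed.

Lemma within_perfect_proper z : F z -> ProperFilter (within F z^').
Proof.
move=> Fz; apply: Build_ProperFilter_ex => A; rewrite /within/= => zA.
have : limit_point F z by rewrite F_perfect.2.
move/(_ _ zA) => [w [wz Fw /= wA]].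
by exists w; apply: wA => //; exact/eqP.
Qed.

Lemma near_diff_quotient z u : F z -> u != z ->
  diff_quotient f u w @[w --> within F (nbhs z)] --> diff_quotient f u z.
Proof.
move=> Fz uz.
have fz : f w @[w --> within F (nbhs z)] --> f z.
  apply: rnorm_cvg => e e0; apply/nbhs_rnormP; exists (e / (K + 1)).
    by rewrite divr_gt0// ltr_wpDl.
  move=> w zw Fw; apply: le_lt_trans (CL_bound_lipschitz K0 fK Fz Fw) _.
  move: zw; rewrite ltr_pdivlMr ?ltr_wpDl//; apply: le_lt_trans.
  by rewrite mulrC ler_wpM2l ?rnorm_ge0// lerDl.
have zz : w @[w --> within F (nbhs z)] --> z by exact: cvg_within.
have num : f w - f u @[w --> within F (nbhs z)] --> f z - f u.
  by apply: cvgB; [exact: fz|exact: cvg_cst].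
have den : w - u @[w --> within F (nbhs z)] --> z - u.
  by apply: cvgB; [exact: zz|exact: cvg_cst].
have zu : z - u != 0 by rewrite subr_eq0 eq_sym.
exact: cvgM _ _ _ num (cvgV zu den).
Qed.

Lemma diff_quotient_radius z u (e : R) : F z -> u != z -> 0 < e ->
  exists2 r : R, 0 < r & forall w, F w -> rnorm (z - w) < r ->
    w != u /\ rnorm (diff_quotient f u z - diff_quotient f u w) < e.
Proof.
move=> Fz uz e0; have /cvg_rnormP/(_ e e0) := near_diff_quotient Fz uz.
move=> /nbhs_rnormP[r r0 rP]; exists (Num.min r (rnorm (z - u))).
  rewrite lt_min r0 lt_neqAle rnorm_ge0 andbT eq_sym.
  by apply: contra_neq uz => /rnorm_eq0/subr0_eq.
move=> w Fw; rewrite lt_min => /andP[wr wu]; split; last exact: rP.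
by apply/eqP => wuE; rewrite wuE ltxx in wu.
Qed.

(** Points u 0, u 1, ... of F so close to z, each so much closer than the
    previous ones, that the divided difference at u m and u n is almost the one
    at z and at the more remote of the two points; this is prescribed to be
    near l true or l false according to the parity. *)
Lemma alternating_points z (l : bool -> R[i]) (e : R) : F z -> 0 < e ->
  (forall b A d, (within F z^') A -> 0 < d ->
    exists2 w, A w & rnorm (l b - diff_quotient f z w) < d) ->
  exists u : nat -> R[i], (forall n, F (u n)) /\ forall m n, (m < n)%N ->
    u n != u m /\ rnorm (l (odd m) - diff_quotient f (u m) (u n)) < e.
Proof.
move=> Fz e0 lP; have e20 : 0 < e / 2 by rewrite divr_gt0.
have /choice[pick pickP] : forall br : bool * R, exists w, 0 < br.2 ->
    [/\ F w, w != z, rnorm (z - w) < br.2 &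
        rnorm (l br.1 - diff_quotient f z w) < e / 2].
  move=> [b r]; have [r0|r0] := ltP 0 r; last by exists 0.
  have [|w [Fw wz zw] we] := lP b (fun w => [/\ F w, w != z & rnorm (z - w) < r])
    (e / 2) _ e20; last by exists w.
  by apply/nbhs_rnormP; exists r => //= w zw wz Fw.
have /choice[rad radP] : forall u, exists r : R, F u -> u != z -> 0 < r /\
    forall w, F w -> rnorm (z - w) < r ->
      w != u /\ rnorm (diff_quotient f u z - diff_quotient f u w) < e / 2.
  move=> u; have [->|uz] := eqVneq u z; first by exists 0.
  by have [r r0 rP] := diff_quotient_radius Fz uz e20; exists r.
pose r := fix r n := if n is n'.+1
  then Num.min (r n') (rad (pick (odd n', r n'))) else 1 : R.
pose u n := pick (odd n, r n).
have r0 n : 0 < r n.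
  elim: n => [|n IH]; first exact: ltr01.
  rewrite /= lt_min IH/=; have [Fu uz _ _] := pickP (odd n, r n) IH.
  by have [] := radP _ Fu uz.
have uP n : [/\ F (u n), u n != z, rnorm (z - u n) < r n &
    rnorm (l (odd n) - diff_quotient f z (u n)) < e / 2].
  exact: (pickP (odd n, r n) (r0 n)).
have r_le m n : (m <= n)%N -> r n <= r m.
  move=> /subnKC <-; elim: (n - m)%N => [|k IH]; first by rewrite addn0.
  by rewrite addnS; apply: le_trans IH; rewrite /= ge_min lexx.
exists u; split=> [n|m n mn]; first by case: (uP n).
have [Fm mz _ lm] := uP m; have [Fn _ zn _] := uP n.
have [_ /(_ (u n) Fn)[|un umn]] := radP _ Fm mz.
  apply: lt_le_trans zn _; apply: le_trans (r_le _ _ mn) _.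
  by rewrite /= ge_min lexx orbT.
split=> //; apply: le_lt_trans (rnorm_triangle _ (diff_quotient f z (u m)) _) _.
by rewrite (splitr e) ltrD// diff_quotientC.
Qed.

(** If the difference quotients at z had two cluster points, the divided
    differences on suitable points near z would form a triangular matrix,
    up to an arbitrarily small error; the Haar matrices show that triangular
    truncation is not a Schur multiplier. *)
Lemma CL_bound_differentiable z : F z -> cdifferentiable_at F f z.
Proof.
move=> Fz; have FF := within_perfect_proper Fz.
apply: contrapT => not_diff.
have [|l [l12 lP]] := @bounded_not_cvg _ _ _ FF (diff_quotient f z) K _ not_diff.
  apply: (@filterS _ (within F z^') _ F); last exact: withinT.
  by move=> w Fw; exact: (CL_bound_divided_difference_le K0 fK Fw Fz).
pose d := rnorm (l true - l false).
have d0 : 0 < d.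
  rewrite lt_neqAle rnorm_ge0 andbT eq_sym.
  by apply: contra_neq l12 => /rnorm_eq0/subr0_eq.
(* k is a square so that the bound sqrt k of the Haar matrix is the integer q *)
pose q := (Num.truncn (4 * (K + 1) / d)).+1; pose k := (q * q)%N.
have qd : 4 * (K + 1) < q%:R * d by rewrite -ltr_pdivrMr// truncnS_gt.
pose N := (2 ^ k)%N; pose h (i j : 'I_N) := haar_mx R k i j.
pose A := \sum_i \sum_j `|h i j|.
have A0 : 0 <= A by do 2 (apply: sumr_ge0 => ? _).
have e0 : 0 < (1 + A)^-1 by rewrite invr_gt0; lra.
have [u [Fu uP]] := alternating_points Fz e0 lP.
pose s (i : 'I_N) := u i.*2; pose t (j : 'I_N) := u j.*2.+1.
have stP i j : s i != t j /\
    rnorm (l (j < i)%N - (f (s i) - f (t j)) / (s i - t j)) < (1 + A)^-1.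
  rewrite /s /t -/(diff_quotient f (u j.*2.+1) (u i.*2)).
  have [ji|ij] := ltnP j i.
    have [|uij] := uP j.*2.+1 i.*2; first by rewrite -doubleS leq_double.
    by rewrite /= odd_double.
  have [|uij] := uP i.*2 j.*2.+1; first by rewrite ltnS leq_double.
  by rewrite eq_sym diff_quotientC odd_double.
have hform x y : rnorm (\sum_i \sum_j (h i j)%:C * x j * y i) <=
    q%:R * l2fin (index_enum 'I_N) x * l2fin (index_enum 'I_N) y.
  apply: le_trans (haar_mx_form _ _) _.
  by rewrite /k natrM -expr2 sqrtr_sqr ger0_norm.
(* Y is the form of the Schur product of the divided differences with the Haar
   matrix at the constant vectors 1, X the one of its triangular model *)
have := CL_bound_rect K0 fK (ler0n _ q) (fun=> Fu _) (fun=> Fu _)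
  (fun i j => (stP i j).1) hform (fun=> 1) (fun=> 1).
rewrite -!mulrA -expr2 sqr_l2fin rnorm1 expr1n sumr_const card_ord.
set Y := \sum_i _ => YK.
pose X := \sum_(i < N) \sum_(j < N) l (j < i)%N * (h i j)%:C.
have XE : X = - (l true - l false) * (k%:R * N%:R / 4)%:C.
  have -> : X = \sum_(i < N) \sum_(j < N) (l false * (h i j)%:C) + (l true - l false) *
      (\sum_(i < N) \sum_(j < N) (j < i)%:R * h i j)%:C.
    rewrite rmorph_sum/= mulr_sumr -big_split/=; apply: eq_bigr => i _.
    rewrite rmorph_sum/= mulr_sumr -big_split/=; apply: eq_bigr => j _.
    by case: (j < i)%N; rewrite ?mul1r ?mul0r ?mulr0 ?addr0// -mulrDl addrC subrK.
  rewrite exchange_big/= big1 ?add0r => [|j _]; last first.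
    by rewrite -mulr_sumr -rmorph_sum haar_mx_column ?mulr0.
  by rewrite haar_mx_lower rmorphN mulrN mulNr.
have XY : rnorm (X - Y) <= 1.
  apply: (@le_trans _ _ ((1 + A)^-1 * A)); last first.
    by rewrite mulrC ler_pdivrMr; lra.
  rewrite -sumrB mulr_sumr; apply: le_trans (rnorm_sum _ _ _) _.
  apply: ler_sum => i _; rewrite -sumrB mulr_sumr.
  apply: le_trans (rnorm_sum _ _ _) _; apply: ler_sum => j _.
  rewrite !mulr1 -mulrBl rnormM rnorm_real ler_wpM2r//.
  exact: ltW (stP i j).2.
have N1 : 1 <= N%:R :> R by rewrite ler1n expn_gt0.
have q1 : 1 <= q%:R :> R by rewrite ler1n.
have : rnorm X <= 1 + K * (q%:R * N%:R).
  by rewrite -(subrK Y X); apply: le_trans (rnormD_le _ _) _; rewrite lerD.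
rewrite XE rnormM rnormN -/d rnorm_real ger0_norm ?divr_ge0 ?mulr_ge0//.
rewrite natrM leNgt => /negP; apply.
have qN : 1 <= q%:R * N%:R :> R by rewrite mulr_ege1.
have : 4 * (K + 1) * (q%:R * N%:R) < q%:R * d * (q%:R * N%:R).
  by rewrite ltr_pM2r// (lt_le_trans ltr01).
have := ler_wpM2l K0 qN.
set P := q%:R * N%:R in qN *.
have -> : d * (q%:R * q%:R * N%:R / 4) = q%:R * d * P / 4 by rewrite /P; ring.
lra.
Qed.

End Differentiability.

(** * The divided difference as a Schur multiplier *)

Section DividedDifferenceMultiplier.
Variables (R : realType) (F : set R[i]) (f : R[i] -> R[i]) (K : R).
Hypotheses (F_perfect : perfect_set F) (K0 : 0 <= K) (fK : CL_bound F f K).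

Lemma set_val_in (s : F) : F (val s).
Proof. exact: set_mem (valP s). Qed.

(** Off the diagonal this is the continuity of f, on the diagonal its
    differentiability. *)
Lemma near_divided_difference (s t : F) (e : R) : 0 < e ->
  \forall w \near within F (val t)^', val s != w /\
    rnorm (divided_difference f s t - (f (val s) - f w) / (val s - w)) < e.
Proof.
move=> e0; have Ft := set_val_in t.
rewrite /divided_difference; have [->|st] := eqVneq s t.
  have /cvg_rnormP/(_ e e0) := CL_bound_differentiable F_perfect K0 fK Ft.
  have neq : within F (val t)^' [set w | w != val t].
    by apply: filterS (nbhs_dnbhs_neq (val t)) => w wt _.
  move=> lim_t; apply: filterS2 neq lim_t => w /= wt we; split; first by rewrite eq_sym.
  by rewrite -[X in _ - X]/(diff_quotient f w (val t)) diff_quotientC.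
have st' : val s != val t by apply: contra_neq st => /val_inj.
have [r r0 rP] := diff_quotient_radius K0 fK Ft st' e0.
have tr : \forall w \near (val t)^', rnorm (val t - w) < r.
  by apply: (@nbhs_dnbhs _ _ _); apply/nbhs_rnormP; exists r.
apply: filterS tr => w tw Fw; have [ws we] := rP w Fw tw.
split; first by rewrite eq_sym.
by rewrite -[(f (val s) - f w) / _]/(diff_quotient f w (val s)) diff_quotientC
  -[(f (val s) - f (val t)) / _]/(diff_quotient f (val t) (val s)) diff_quotientC.
Qed.

(** The diagonal of the divided difference is reached by moving the points that
    index the columns: F has no isolated point, so each of them is a limit of
    points of F that differ from all points that index the rows. *)
Lemma CL_bound_schur_le : schur_le (@divided_difference R F f) K.
Proof.
split=> // a M aM; have M0 := aM.1; split=> [|E G x y]; first exact: mulr_ge0.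
pose ext (A : {fset F}) (u : A -> R[i]) (i : F) := oapp u 0 (insub i).
have extE (A : {fset F}) (u : A -> R[i]) (i : A) : ext A u (val i) = u i by rewrite /ext valK.
have l2finE (A : {fset F}) (u : F -> R[i]) :
    l2fin A u = l2fin (index_enum A) (fun i => u (val i)).
  by rewrite /l2fin big_seq_fsetE.
have formE (b : F -> F -> R[i]) (u v : F -> R[i]) : mxform E G b u v =
    \sum_(i : E) \sum_(j : G) b (val i) (val j) * u (val j) * v (val i).
  by rewrite /mxform big_seq_fsetE; apply: eq_bigr => i _; rewrite big_seq_fsetE.
apply/ler_addgt0Pr => e e0.
pose C := \sum_(i : E) \sum_(j : G) rnorm (a (val i) (val j) * x (val j) * y (val i)).
have C0 : 0 <= C by do 2 (apply: sumr_ge0 => ? _); exact: rnorm_ge0.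
have d0 : 0 < e / (1 + C) by rewrite divr_gt0// ltr_pwDl.
have /choice[t' t'P] : forall j : G, exists w, F w /\ forall i : E,
    val (val i) != w /\ rnorm (divided_difference f (val i) (val j) -
      (f (val (val i)) - f w) / (val (val i) - w)) < e / (1 + C).
  move=> j; have FF := within_perfect_proper F_perfect (set_val_in (val j)).
  have near_j := @filter_forall _ _ _ _ _ (fun i : E =>
    near_divided_difference (val i) (val j) d0).
  have [w [Fw wP]] := filter_ex (filterI (withinT F _) (near_j _)).
  by exists w.
have form_le (u : G -> R[i]) (v : E -> R[i]) :
    rnorm (\sum_(i : E) \sum_(j : G) a (val i) (val j) * u j * v i) <=
    M * l2fin (index_enum G) u * l2fin (index_enum E) v.
  have := aM.2 E G (ext G u) (ext E v); rewrite formE !l2finE.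
  rewrite (eq_l2fin (x' := u)) => [|i _]; last by rewrite extE.
  rewrite (eq_l2fin (x' := v)) => [|i _]; last by rewrite extE.
  congr (rnorm _ <= _); apply: eq_bigr => i _; apply: eq_bigr => j _.
  by rewrite !extE.
have := CL_bound_rect K0 fK M0 (fun i : E => set_val_in (val i))
  (fun j => (t'P j).1) (fun i j => ((t'P j).2 i).1) form_le
  (fun j => x (val j)) (fun i => y (val i)).
rewrite -!l2finE formE; set Y := \sum_i _ => YKM.
rewrite -[X in rnorm X](subrK Y) addrC.
apply: le_trans (rnormD_le _ _) _; apply: lerD => //.
apply: (@le_trans _ _ (e / (1 + C) * C)); last first.
  by rewrite -mulrA ger_pMr// mulrC ler_pdivrMr ?ltr_pwDl// mul1r lerDr.
rewrite -sumrB mulr_sumr; apply: le_trans (rnorm_sum _ _ _) _.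
apply: ler_sum => i _; rewrite -sumrB mulr_sumr.
apply: le_trans (rnorm_sum _ _ _) _; apply: ler_sum => j _.
have factor (p q b u v : R[i]) : p * b * u * v - q * b * u * v = (p - q) * (b * u * v).
  by ring.
rewrite /schur_product factor rnormM ler_wpM2r ?rnorm_ge0//.
exact: ltW ((t'P j).2 i).2.
Qed.

End DividedDifferenceMultiplier.

(** * Inner products and spectra *)

Section HilbertSpaces.
Variables (R : realType) (H : hilbertSpace R).
Implicit Types (x y u v : H) (c : R[i]).
Local Notation "<[ x , y ]>" := (hdot H x y).

Lemma hdotC x y : <[x, y]> = (<[y, x]>)^*.
Proof. by rewrite (@hermitian_subproof _ _ _ _ (hdot H) x y) expr0 mul1r. Qed.

Lemma hdotDl x y u : <[x + y, u]> = <[x, u]> + <[y, u]>.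
Proof. exact: linearDl. Qed.

Lemma hdotBl x y u : <[x - y, u]> = <[x, u]> - <[y, u]>.
Proof. exact: linearBl. Qed.

Lemma hdotZl c x u : <[c *: x, u]> = c * <[x, u]>.
Proof. exact: linearZl_LR. Qed.

Lemma hdotBr x y u : <[u, x - y]> = <[u, x]> - <[u, y]>.
Proof. exact: linearBr. Qed.

Lemma hdotZr c x u : <[u, c *: x]> = c^* * <[u, x]>.
Proof. exact: linearZr_LR. Qed.

Lemma hdot_suml (I : Type) (r : seq I) (w : I -> H) u :
  <[\sum_(i <- r) w i, u]> = \sum_(i <- r) <[w i, u]>.
Proof.
apply: (big_morph (fun x => <[x, u]>)) => [x y|]; first exact: hdotDl.
by rewrite -(scale0r (0 : H)) hdotZl mul0r.
Qed.

Lemma hdot_sumr (I : Type) (r : seq I) (w : I -> H) u :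
  <[u, \sum_(i <- r) w i]> = \sum_(i <- r) <[u, w i]>.
Proof.
apply: (big_morph (fun x => <[u, x]>)) => [x y|]; first exact: linearDr.
by rewrite -(scale0r (0 : H)) hdotZr rmorph0 mul0r.
Qed.

Lemma hdotxx x : <[x, x]> = (rnorm x ^+ 2)%:C.
Proof. by rewrite -hdot_norm -rnormE rmorphXn. Qed.

Lemma hdot_le x y : rnorm <[x, y]> <= rnorm x * rnorm y.
Proof.
have [y0|y0] := eqVneq (rnorm y) 0.
  have -> : <[x, y]> = 0.
    by rewrite (rnorm_eq0 y0) -(scale0r (0 : H)) hdotZr rmorph0 mul0r.
  by rewrite rnorm0 mulr_ge0 ?rnorm_ge0.
have ygt0 : 0 < rnorm y by rewrite lt_neqAle eq_sym y0 rnorm_ge0.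
pose a := <[x, y]>.
(* the squared distance, times the fourth power of the norm of y, from x to
   its projection on y *)
have : 0 <= rnorm ((rnorm y ^+ 2)%:C *: x - a *: y) ^+ 2 by exact: sqr_ge0.
rewrite -ler0c -(hdotxx (_ - _)) !hdotBl !hdotBr !hdotZl !hdotZr !hdotxx (hdotC y x) -/a.
rewrite conj_Creal ?complex_real//.
have -> : (rnorm y ^+ 2)%:C * ((rnorm y ^+ 2)%:C * (rnorm x ^+ 2)%:C) -
    (rnorm y ^+ 2)%:C * (a^* * a) -
    (a * ((rnorm y ^+ 2)%:C * a^*) - a * (a^* * (rnorm y ^+ 2)%:C)) =
    (rnorm y ^+ 2)%:C * ((rnorm y ^+ 2)%:C * (rnorm x ^+ 2)%:C - a * a^*) by ring.
rewrite mulC_conj -rmorphM -rmorphB -rmorphM ler0c pmulr_rge0 ?exprn_gt0//.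
rewrite subr_ge0 mulrC -exprMn ler_pXn2r// ?nnegrE ?mulr_ge0 ?rnorm_ge0//.
Qed.

Lemma rnorm_hdot_le x (c : R) : 0 <= c ->
  (forall y, rnorm <[x, y]> <= c * rnorm y) -> rnorm x <= c.
Proof.
move=> c0 /(_ x); rewrite hdotxx rnorm_real ger0_norm ?sqr_ge0// expr2.
have := rnorm_ge0 x; rewrite le_eqVlt => /predU1P[<-//|x0].
by rewrite ler_pM2r.
Qed.

(** The Neumann series, in the form of the iteration for the equation
    N x - l x = y. *)
Lemma spectrum_bounded (N : H -> H) (M : R) (l : R[i]) : linear N -> 0 <= M ->
  (forall x, rnorm (N x) <= M * rnorm x) -> spectrum N l -> rnorm l <= M.
Proof.
move=> Nl M0 NM spl; rewrite leNgt; apply/negP => Ml; apply: spl.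
have l0 : 0 < rnorm l by exact: le_lt_trans Ml.
have lneq0 : l != 0 by apply: contraTneq l0 => ->; rewrite rnorm0 ltxx.
have below x : (rnorm l - M) * rnorm x <= rnorm (N x - l *: x).
  rewrite mulrBl lerBlDr; apply: le_trans (lerD (lexx _) (NM x)).
  by rewrite -rnormZ rnormBC -{1}(subrK (N x) (l *: x)) rnormD_le.
have lM0 : 0 < rnorm l - M by rewrite subr_gt0.
have inj x y : N x - l *: x = N y - l *: y -> x = y.
  move=> xy; apply/eqP; rewrite -subr_eq0; apply/eqP/rnorm_le0.
  rewrite -(pmulr_rle0 _ lM0); apply: le_trans (below _) _.
  have -> : N (x - y) - l *: (x - y) = (N x - l *: x) - (N y - l *: y).
    by rewrite linear_opB// scalerBr !opprB addrACA [RHS]addrACA [- N y - _]addrC.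
  by rewrite xy subrr rnorm0.
have surj y : exists x, N x - l *: x = y.
  pose it := fix it n := if n is n'.+1 then l^-1 *: (N (it n') - y) else 0 : H.
  have itS n : N (it n) = l *: it n.+1 + y by rewrite /= scalerA divff// scale1r subrK.
  pose q := M / rnorm l.
  have q0 : 0 <= q by rewrite divr_ge0// ltW.
  have q1 : q < 1 by rewrite ltr_pdivrMr// mul1r.
  have it_step (u v : H) : rnorm (l^-1 *: (N u - y) - l^-1 *: (N v - y)) <= q * rnorm (u - v).
    rewrite -scalerBr opprB addrA subrK -linear_opB// rnormZ rnormV /q.
    by rewrite mulrC mulrAC ler_pM2r ?invr_gt0.
  pose D := rnorm (it 1%N) / (1 - q).
  have D0 : 0 <= D by rewrite divr_ge0 ?rnorm_ge0// subr_ge0 ltW.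
  have it_bound k : rnorm (it k) <= D.
    elim: k => [|k IH]; first by rewrite rnorm0.
    rewrite -(subrK (it 1%N) (it k.+1)); apply: le_trans (rnormD_le _ _) _.
    have := it_step (it k) 0; rewrite subr0 -[l^-1 *: (N 0 - y)]/(it 1%N) => h.
    have -> : D = q * D + rnorm (it 1%N).
      by rewrite /D; field; rewrite subr_eq0 gt_eqF.
    by rewrite lerD//; apply: le_trans h _; rewrite ler_wpM2l.
  have it_cauchy n k : rnorm (it (n + k)%N - it n) <= q ^+ n * D.
    elim: n => [|n IH]; first by rewrite add0n subr0 expr0 mul1r.
    rewrite addSn exprS -mulrA; apply: le_trans (it_step _ _) _.
    by rewrite ler_wpM2l.
  have small (e : R) : 0 < e -> \forall n \near \oo, q ^+ n * D < e.
    move=> e0; have : q ^+ n * D @[n --> \oo] --> 0 * D.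
      by apply: cvgMl; apply: cvg_expr; rewrite ger0_norm.
    rewrite mul0r => /cvgrPdist_lt/(_ e e0); apply: filterS => n.
    by rewrite sub0r normrN ger0_norm// mulr_ge0// exprn_ge0.
  have [x itx] : exists x : H, it n @[n --> \oo] --> x.
    apply/cvg_ex; apply: cauchy_cvg; apply: cauchy_exP => e e0.
    have eE : e = (complex.Re e)%:C by rewrite RRe_real// gtr0_real.
    rewrite eE ltcR in e0; have [n _ /(_ n (leqnn n)) nD] := small _ e0.
    exists (it n); exists n => // m /= nm; rewrite -ball_normE /ball_/= eE -rnormE ltcR.
    by rewrite rnormBC -(subnKC nm); apply: le_lt_trans (it_cauchy _ _) nD.
  exists x; apply/eqP; rewrite -subr_eq0; apply/eqP/rnorm_le0/ler_addgt0Pr => e e0.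
  rewrite add0r; pose d := e / (M + rnorm l).
  have Ml0 : 0 < M + rnorm l by lra.
  have d0 : 0 < d by rewrite divr_gt0.
  have /cvg_rnormP/(_ d d0)[n _ nP] := itx.
  have -> : N x - l *: x - y = N (x - it n) + l *: (it n.+1 - x).
    have regroup (a b u v : H) : a - v - u = a - (b + u) + (b - v).
      rewrite opprD -[LHS]addrA -[RHS]addrA; congr (a + _).
      by rewrite addrACA addNr add0r addrC.
    by rewrite linear_opB// itS scalerBr -regroup.
  apply: le_trans (rnormD_le _ _) _; rewrite rnormZ rnormBC.
  have := NM (x - it n); have := nP n (leqnn n); have := nP n.+1 (leqnSn n).
  rewrite /= => h1 h2 h3.
  have -> : e = M * d + rnorm l * d by rewrite -mulrDl mulrC divfK// gt_eqF.
  apply: lerD; last by rewrite ler_wpM2l ?rnorm_ge0// ltW.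
  by apply: le_trans h3 _; rewrite ler_wpM2l// ltW.
have /choice[S SP] := surj.
exists S; split; last by move=> x; exact: SP.
  split=> [c x y|].
    apply: inj; rewrite SP Nl scalerDr scalerA mulrC -scalerA opprD addrACA -scalerBr.
    by rewrite !SP.
  exists (rnorm l - M)^-1 => x; rewrite mulrC ler_pdivlMr// mulrC.
  by have := below (S x); rewrite SP.
by move=> x; apply: inj; rewrite SP.
Qed.

End HilbertSpaces.

(** * Functional calculus with a partition of unity *)

Section WithinContinuity.
Variables (R : realType) (A : set R[i]).
Implicit Types (g h : R[i] -> R[i]).

Lemma within_continuousD g h : {within A, continuous g} -> {within A, continuous h} ->
  {within A, continuous (fun z => g z + h z)}.
Proof. by move=> gc hc z; apply: cvgD; [exact: gc|exact: hc]. Qed.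

Lemma within_continuousM g h : {within A, continuous g} -> {within A, continuous h} ->
  {within A, continuous (fun z => g z * h z)}.
Proof. by move=> gc hc z; apply: cvgM; [exact: gc|exact: hc]. Qed.

Lemma within_continuous_cst (c : R[i]) : {within A, continuous (fun=> c)}.
Proof. by move=> z; exact: cvg_cst. Qed.

Lemma within_continuous_id : {within A, continuous (fun z => z)}.
Proof. by apply: continuous_subspaceT => z; exact: cvg_id. Qed.

Lemma within_continuousZ (c : R[i]) g : {within A, continuous g} ->
  {within A, continuous (fun z => c * g z)}.
Proof.
by move=> gc; exact: (within_continuousM (within_continuous_cst (c := c)) gc).
Qed.

Lemma within_continuousB g h : {within A, continuous g} -> {within A, continuous h} ->
  {within A, continuous (fun z => g z - h z)}.
Proof. by move=> gc hc z; apply: cvgB; [exact: gc|exact: hc]. Qed.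

Lemma within_continuous_conj g : {within A, continuous g} ->
  {within A, continuous (fun z => (g z)^*)}.
Proof.
move=> gc z; apply: rnorm_cvg => e e0; have /cvg_rnormP/(_ e e0) := gc z.
by apply: filterS => w; rewrite -rmorphB rnorm_conj.
Qed.

Lemma within_continuous_sum (I : Type) (r : seq I) (g : I -> R[i] -> R[i]) :
  (forall i, {within A, continuous (g i)}) ->
  {within A, continuous (fun z => \sum_(i <- r) g i z)}.
Proof.
move=> gc; elim: r => [|i r IH].
  under eq_fun do rewrite big_nil; exact: within_continuous_cst.
under eq_fun do rewrite big_cons; exact: (within_continuousD (gc i) IH).
Qed.

End WithinContinuity.

Section FunctionalCalculus.
Variables (R : realType) (H : hilbertSpace R) (N : H -> H).
Variable Phi : (R[i] -> R[i]) -> H -> H.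
Hypothesis PhiP : is_functional_calculus N Phi.
Implicit Types (g h : R[i] -> R[i]) (x y : H) (m : R).
Local Notation "<[ x , y ]>" := (hdot H x y).
Local Notation cont g := ({within spectrum N, continuous g}).

Lemma fc_linear g : cont g -> linear (Phi g).
Proof. by move=> gc; have [] := fc_bounded PhiP gc. Qed.

Lemma fc_sub g h x : cont g -> cont h -> Phi (fun z => g z - h z) x = Phi g x - Phi h x.
Proof.
move=> gc hc; have hc' := within_continuousZ (c := -1) hc.
have -> : (fun z => g z - h z) = (fun z => g z + -1 * h z).
  by apply/funext => z; rewrite mulN1r.
by rewrite (fc_add PhiP gc hc') (fc_scale PhiP (-1) hc) scaleN1r.
Qed.

Lemma fc_dist g h m x : cont g -> cont h -> 0 <= m ->
  (forall z, spectrum N z -> rnorm (g z - h z) <= m) ->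
  rnorm (Phi g x - Phi h x) <= m * rnorm x.
Proof.
move=> gc hc m0 ghm; rewrite -(fc_sub _ gc hc).
exact: (fc_contractive PhiP (within_continuousB gc hc)).
Qed.

Lemma fc_eq g h x : cont g -> cont h ->
  (forall z, spectrum N z -> g z = h z) -> Phi g x = Phi h x.
Proof.
move=> gc hc gh; apply/eqP; rewrite -subr_eq0; apply/eqP/rnorm_le0.
rewrite -(mul0r (rnorm x)); apply: (fc_dist _ gc hc) => // z zN.
by rewrite (gh z zN) subrr rnorm0.
Qed.

Lemma fc_sum (I : Type) (r : seq I) (g : I -> R[i] -> R[i]) x :
  (forall i, cont (g i)) ->
  Phi (fun z => \sum_(i <- r) g i z) x = \sum_(i <- r) Phi (g i) x.
Proof.
move=> gc; elim: r => [|i r IH].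
  rewrite big_nil; have -> : (fun z => \sum_(i <- [::]) g i z) = (fun=> 0 * 0).
    by apply/funext => z; rewrite big_nil mul0r.
  by rewrite (fc_scale PhiP 0 (@within_continuous_cst _ _ 0)) scale0r.
rewrite big_cons -IH; under eq_fun do rewrite big_cons.
by rewrite (fc_add PhiP (gc i) (within_continuous_sum (r := r) gc)).
Qed.

Lemma fc_adjoint g x y : cont g -> <[Phi g x, y]> = <[x, Phi (fun z => (g z)^*) y]>.
Proof. by move=> gc; exact: (fc_star PhiP gc). Qed.

(** For functions g i whose sum of squared moduli is at most m ^+ 2, the column
    of operators Phi (g i) has norm at most m, because the sum of the
    Phi (g i)^* Phi (g i) is the image of the sum of the squared moduli. *)
Lemma fc_column_norm (I : Type) (r : seq I) (g : I -> R[i] -> R[i]) m x :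
  (forall i, cont (g i)) -> 0 <= m ->
  (forall z, spectrum N z -> \sum_(i <- r) rnorm (g i z) ^+ 2 <= m ^+ 2) ->
  \sum_(i <- r) rnorm (Phi (g i) x) ^+ 2 <= (m * rnorm x) ^+ 2.
Proof.
move=> gc m0 gm; pose q i (z : R[i]) : R[i] := (g i z)^* * g i z.
have qc i : cont (q i) by exact/within_continuousM/gc/within_continuous_conj.
have sumE : (\sum_(i <- r) rnorm (Phi (g i) x) ^+ 2)%:C =
    <[x, Phi (fun z => \sum_(i <- r) q i z) x]>.
  rewrite (fc_sum _ _ qc) hdot_sumr rmorph_sum/=; apply: eq_bigr => i _.
  rewrite -hdotxx (fc_adjoint _ _ (gc i)).
  by rewrite (fc_mul PhiP (within_continuous_conj (gc i)) (gc i)).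
have S0 : 0 <= \sum_(i <- r) rnorm (Phi (g i) x) ^+ 2 by exact: sum_sqr_ge0.
rewrite -(ger0_norm S0) -rnorm_real sumE; apply: le_trans (hdot_le _ _) _.
rewrite exprMn [leRHS]mulrC [rnorm x ^+ 2]expr2 -mulrA ler_wpM2l ?rnorm_ge0//.
rewrite mulrC; apply: (fc_contractive PhiP (within_continuous_sum (r := r) qc)).
  exact: sqr_ge0.
move=> z zN; apply: le_trans (gm z zN); apply: le_trans (rnorm_sum _ _ _) _.
by apply: ler_sum => i _; rewrite rnormM rnorm_conj.
Qed.

(** The row of the operators Phi (g i) is the adjoint of the column of the
    Phi (g i)^*. *)
Lemma fc_row_norm (I : Type) (r : seq I) (g : I -> R[i] -> R[i]) m (u : I -> H) :
  (forall i, cont (g i)) -> 0 <= m ->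
  (forall z, spectrum N z -> \sum_(i <- r) rnorm (g i z) ^+ 2 <= m ^+ 2) ->
  rnorm (\sum_(i <- r) Phi (g i) (u i)) <=
  m * Num.sqrt (\sum_(i <- r) rnorm (u i) ^+ 2).
Proof.
move=> gc m0 gm; apply: rnorm_hdot_le => [|y]; first by rewrite mulr_ge0 ?sqrtr_ge0.
rewrite hdot_suml; apply: le_trans (rnorm_sum _ _ _) _.
pose gy i := Phi (fun z => (g i z)^*) y.
apply: (@le_trans _ _ (\sum_(i <- r) rnorm (u i) * rnorm (gy i))).
  by apply: ler_sum => i _; rewrite (fc_adjoint _ _ (gc i)) hdot_le.
apply: le_trans (cauchy_schwarz_sum _ _ _) _.
rewrite mulrAC mulrC ler_wpM2r ?sqrtr_ge0//.
rewrite -[leRHS]ger0_norm ?mulr_ge0 ?rnorm_ge0// -sqrtr_sqr.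
rewrite ler_sqrt ?sqr_ge0//.
apply: (fc_column_norm _ (fun i => within_continuous_conj (gc i)) m0) => z zN.
by under eq_bigr do rewrite rnorm_conj; exact: gm.
Qed.

(** The operators P i := Phi (psi i) below come from functions psi i with
    squares of sum 1 on the spectrum. The map x |-> (P i x)_i is then an
    isometry of H into a direct sum of copies of H, which carries a function
    of N approximately to a diagonal operator. *)
Section PartitionOfUnity.
Variables (I : Type) (r : seq I) (psi : I -> R[i] -> R[i]).
Hypothesis psi_cont : forall i, cont (psi i).
#[local] Arguments psi_cont : clear implicits.
Hypothesis psi_conj : forall i z, (psi i z)^* = psi i z.
Hypothesis psi_sum : forall z, spectrum N z -> \sum_(i <- r) psi i z ^+ 2 = 1.
Local Notation P := (fun i => Phi (psi i)).
Implicit Types (u v : I -> H).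

Definition vnorm u : R := Num.sqrt (\sum_(i <- r) rnorm (u i) ^+ 2).

Lemma psi_sum_rnorm z : spectrum N z -> \sum_(i <- r) rnorm (psi i z) ^+ 2 = 1.
Proof.
move=> zN; apply: complexI; rewrite rmorph_sum/= rmorph1 -(psi_sum zN).
by apply: eq_bigr => i _; rewrite -mulC_conj psi_conj.
Qed.

Lemma partition_row_le u : rnorm (\sum_(i <- r) P i (u i)) <= vnorm u.
Proof.
rewrite -[leRHS]mul1r; apply: (fc_row_norm _ psi_cont ler01) => z zN.
by rewrite psi_sum_rnorm// expr1n.
Qed.

Lemma partition_column_le x : vnorm (fun i => P i x) <= rnorm x.
Proof.
rewrite -[leRHS]ger0_norm ?rnorm_ge0// -sqrtr_sqr ler_sqrt ?sqr_ge0//.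
rewrite -[rnorm x]mul1r; apply: (fc_column_norm _ psi_cont ler01) => z zN.
by rewrite psi_sum_rnorm// expr1n.
Qed.

Lemma partition_sum x : \sum_(i <- r) P i (P i x) = x.
Proof.
rewrite (eq_bigr (fun i => Phi (fun z => psi i z * psi i z) x)) => [|i _]; last first.
  by rewrite (fc_mul PhiP (psi_cont i) (psi_cont i)).
have sqc i := within_continuousM (psi_cont i) (psi_cont i).
rewrite -(fc_sum _ _ sqc) -[RHS](fc_one PhiP).
apply: (fc_eq _ (within_continuous_sum (r := r) sqc) (@within_continuous_cst _ _ 1)) => z zN.
by rewrite -(psi_sum zN); apply: eq_bigr.
Qed.

(** Where psi i does not vanish, g is within m of the constant c i; hence the
    squared moduli of the (c i - g) * psi i have sum at most m ^ 2, and
    [fc_row_norm] applies. *)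
Lemma partition_approx (c : I -> R[i]) g m u : cont g -> 0 <= m ->
  (forall i z, spectrum N z -> psi i z != 0 -> rnorm (c i - g z) <= m) ->
  rnorm (\sum_(i <- r) c i *: P i (u i) - Phi g (\sum_(i <- r) P i (u i))) <=
  m * vnorm u.
Proof.
move=> gc m0 cgm; rewrite (linear_op_sum _ _ _ (fc_linear gc)).
pose q i (z : R[i]) := c i * psi i z - g z * psi i z.
have cpc i := within_continuousZ (c := c i) (psi_cont i).
have gpc i := within_continuousM gc (psi_cont i).
have qc i := within_continuousB (cpc i) (gpc i).
have -> : \sum_(i <- r) c i *: P i (u i) - \sum_(i <- r) Phi g (P i (u i)) =
    \sum_(i <- r) Phi (q i) (u i).
  rewrite -sumrB; apply: eq_bigr => i _.
  rewrite (fc_sub _ (cpc i) (gpc i)) (fc_scale PhiP _ (psi_cont i)).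
  by rewrite (fc_mul PhiP gc (psi_cont i)).
apply: (fc_row_norm _ qc m0) => z zN; rewrite -[leRHS]mulr1 -(psi_sum_rnorm zN) mulr_sumr.
apply: ler_sum => i _; rewrite /q -mulrBl rnormM exprMn.
have [->|psi0] := eqVneq (psi i z) 0; first by rewrite rnorm0 expr0n !mulr0.
rewrite ler_wpM2r ?sqr_ge0// ler_pXn2r ?nnegrE ?rnorm_ge0//.
exact: cgm.
Qed.

Lemma partition_approx_conj (c : I -> R[i]) g m u : cont g -> 0 <= m ->
  (forall i z, spectrum N z -> psi i z != 0 -> rnorm (c i - g z) <= m) ->
  rnorm (\sum_(i <- r) (c i)^* *: P i (u i) -
    Phi (fun z => (g z)^*) (\sum_(i <- r) P i (u i))) <= m * vnorm u.
Proof.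
move=> gc m0 cgm.
apply: (partition_approx _ (within_continuous_conj gc) m0) => i z zN psi0.
by rewrite -rmorphB rnorm_conj cgm.
Qed.

(** In both commutators the function, or the diagonal operator, can be moved to
    the vector on which it acts: each is a difference of two inner products,
    which the two preceding estimates compare. *)
Lemma partition_commutator (B : H -> H) (b : R) (c : I -> R[i]) g m u v :
  linear B -> 0 <= b -> (forall x, rnorm (B x) <= b * rnorm x) ->
  cont g -> 0 <= m ->
  (forall i z, spectrum N z -> psi i z != 0 -> rnorm (c i - g z) <= m) ->
  rnorm (\sum_(i <- r) \sum_(j <- r) (c i - c j) * <[B (P j (u j)), P i (v i)]> -
    <[commutator (Phi g) B (\sum_(j <- r) P j (u j)), \sum_(i <- r) P i (v i)]>) <=
  2 * b * m * vnorm u * vnorm v.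
Proof.
move=> Bl b0 Bb gc m0 cgm.
set U := \sum_(j <- r) P j (u j); set V := \sum_(i <- r) P i (v i).
pose U' := \sum_(j <- r) c j *: P j (u j); pose V' := \sum_(i <- r) (c i)^* *: P i (v i).
have -> : \sum_(i <- r) \sum_(j <- r) (c i - c j) * <[B (P j (u j)), P i (v i)]> =
    <[B U, V']> - <[B U', V]>.
  rewrite /U /U' !linear_op_sum// !hdot_sumr -sumrB; apply: eq_bigr => i _.
  rewrite !hdot_suml -sumrB; apply: eq_bigr => j _.
  by rewrite linear_opZ// hdotZl hdotZr conjCK mulrBl.
rewrite /commutator hdotBl (fc_adjoint _ _ gc).
set V'' := Phi _ V; set U'' := Phi g U.
have -> : <[B U, V']> - <[B U', V]> - (<[B U, V'']> - <[B U'', V]>) =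
    <[B U, V' - V'']> - <[B (U' - U''), V]>.
  by rewrite linear_opB// hdotBr hdotBl; ring.
apply: le_trans (rnormB_le _ _) _.
have U1 := partition_row_le u; have V1 := partition_row_le v.
have VV := partition_approx_conj v gc m0 cgm.
have UU := partition_approx u gc m0 cgm.
have u0 : 0 <= vnorm u by exact: sqrtr_ge0.
have v0 : 0 <= vnorm v by exact: sqrtr_ge0.
have -> : 2 * b * m * vnorm u * vnorm v =
    b * vnorm u * (m * vnorm v) + b * (m * vnorm u) * vnorm v by ring.
apply: lerD; apply: le_trans (hdot_le _ _) _; apply: ler_pM; rewrite ?rnorm_ge0//.
  by apply: le_trans (Bb _) _; rewrite ler_wpM2l.
by apply: le_trans (Bb _) _; rewrite ler_wpM2l.
Qed.

End PartitionOfUnity.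

End FunctionalCalculus.

(** * Schur multipliers on matrices of forms *)

Section FiniteSupport.
Variables (R : realType) (I : choiceType).

Lemma sum_fset_support (V : zmodType) (E A : {fset I}) (g : I -> V) :
  (forall i, i \notin A -> g i = 0) ->
  \sum_(i <- E) g i = \sum_(i <- A) (if i \in E then g i else 0).
Proof.
move=> gA; pose g' i := if i \in E then g i else 0.
have -> : \sum_(i <- E) g i = \sum_(i <- E) g' i.
  by apply: eq_big_seq => i iE; rewrite /g' iE.
rewrite (big_fset_incl _ (fsubsetUl E A)) => [|i _ iE]; last by rewrite /g' (negbTE iE).
rewrite -(big_fset_incl _ (fsubsetUr E A))// => i _ iA.
by rewrite /g' gA// if_same.
Qed.

Lemma l2fin_restrict (E A : {fset I}) (x : I -> R[i]) :
  l2fin A (fun i => if i \in E then x i else 0) <= l2fin E x.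
Proof.
apply: le_trans (l2fin_support (E := E) _ _) _ => [i /negbTE ->//|].
rewrite le_eqVlt; apply/orP; left; apply/eqP/eq_l2fin => i iE.
by rewrite iE.
Qed.

End FiniteSupport.

Section OperatorEntries.
Variables (R : realType) (I : choiceType).

Lemma mxform_support (A B E G : {fset I}) (a : I -> I -> R[i]) (x y : I -> R[i]) :
  (forall s t, s \notin A -> a s t = 0) -> (forall s t, t \notin B -> a s t = 0) ->
  mxform E G a x y = mxform A B a (fun t => if t \in G then x t else 0)
    (fun s => if s \in E then y s else 0).
Proof.
move=> aA aB; rewrite /mxform (@sum_fset_support _ _ E A) => [|s sA]; last first.
  by rewrite big1// => t _; rewrite aA// !mul0r.
apply: eq_bigr => s _; rewrite (@sum_fset_support _ _ G B) => [|t tB]; last first.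
  by rewrite aB// !mul0r.
case: ifP => _; last by rewrite big1// => t _; rewrite mulr0.
by apply: eq_bigr => t _; case: ifP => _ //; rewrite mulr0 mul0r.
Qed.

Lemma schur_le_entry (Phi : I -> I -> R[i]) (K : R) s t :
  schur_le Phi K -> rnorm (Phi s t) <= K.
Proof.
move=> [K0 PhiK]; pose a i j : R[i] := if (i == s) && (j == t) then 1 else 0.
have a1 : mxform_le a 1.
  split=> // E G x y; rewrite mul1r.
  rewrite (@mxform_support [fset s]%fset [fset t]%fset E G) => [||].
  - rewrite /mxform !big_seq_fset1 /a !eqxx mul1r rnormM.
    by apply: ler_pM; rewrite ?rnorm_ge0//; case: ifP => iE;
      rewrite ?rnorm0 ?l2fin_ge0// le_l2fin.
  - by move=> i j; rewrite inE /a => /negbTE ->.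
  - by move=> i j; rewrite inE /a andbC => /negbTE ->.
have := mxform_le_entry s t (PhiK _ _ a1).
by rewrite /schur_product /a !eqxx !mulr1.
Qed.

(** A Schur multiplier acts with the same bound on matrices whose entries are
    operators or, as here, sesquilinear forms: for fixed vectors u t and v s,
    the form of the entries at u t and v s is that of a scalar matrix, the
    entries at the normalized vectors, at the scalar vectors of the norms. *)
Lemma schur_le_forms (H : hilbertSpace R) (Phi : I -> I -> R[i]) (K Q : R)
    (A : {fset I}) (beta : I -> I -> H -> H -> R[i]) : schur_le Phi K -> 0 <= Q ->
  (forall s t c u v, beta s t (c *: u) v = c * beta s t u v) ->
  (forall s t c u v, beta s t u (c *: v) = c^* * beta s t u v) ->
  (forall u v : I -> H,
    rnorm (\sum_(s <- A) \sum_(t <- A) beta s t (u t) (v s)) <=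
      Q * vnorm A u * vnorm A v) ->
  forall u v : I -> H,
    rnorm (\sum_(s <- A) \sum_(t <- A) Phi s t * beta s t (u t) (v s)) <=
      K * Q * vnorm A u * vnorm A v.
Proof.
move=> [K0 PhiK] Q0 betaZl betaZr betaQ u v.
have normal (w : I -> H) : exists w' : I -> H, (forall i, rnorm (w' i) <= 1) /\
    forall i, w i = (rnorm (w i))%:C *: w' i.
  exists (fun i => (rnorm (w i))^-1%:C *: w i); split=> i.
    rewrite rnormZ rnorm_real ger0_norm ?invr_ge0 ?rnorm_ge0//.
    by have [->|w0] := eqVneq (rnorm (w i)) 0; rewrite ?mulr0 ?ler01// mulVf.
  have [w0|w0] := eqVneq (rnorm (w i)) 0.
    by rewrite w0 scale0r (rnorm_eq0 w0).
  by rewrite scalerA -rmorphM/= divff// scale1r.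
have [u' [u'1 uE]] := normal u; have [v' [v'1 vE]] := normal v.
pose a s t : R[i] := if (s \in A) && (t \in A) then beta s t (u' t) (v' s) else 0.
have vnorm_le (x : I -> R[i]) (w : I -> H) : (forall i, rnorm (w i) <= 1) ->
    vnorm A (fun i => x i *: w i) <= l2fin A x.
  move=> w1; rewrite ler_sqrt ?sum_sqr_ge0//; apply: ler_sum => i _.
  rewrite ler_pXn2r ?nnegrE ?rnorm_ge0// rnormZ.
  by rewrite ler_piMr ?rnorm_ge0.
have aQ : mxform_le a Q.
  split=> // E G x y.
  rewrite (@mxform_support A A E G) => [||]; first last.
  - by move=> s t /negbTE tA; rewrite /a tA andbF.
  - by move=> s t /negbTE sA; rewrite /a sA.
  set x' := fun _ => _; set y' := fun _ => _.
  have -> : mxform A A a x' y' = \sum_(s <- A) \sum_(t <- A)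
      beta s t (x' t *: u' t) ((y' s)^* *: v' s).
    apply: eq_big_seq => s sA; apply: eq_big_seq => t tA.
    by rewrite /a sA tA/= betaZl betaZr conjCK; ring.
  apply: le_trans (betaQ _ _) _; rewrite -!mulrA ler_wpM2l//.
  apply: ler_pM; rewrite ?sqrtr_ge0//.
    exact: le_trans (vnorm_le _ _ u'1) (l2fin_restrict _ _ _).
  apply: le_trans (vnorm_le _ _ v'1) _.
  rewrite (eq_l2fin (x' := y')) => [|s _]; last by rewrite rnorm_conj.
  exact: l2fin_restrict.
have := (PhiK _ _ aQ).2 A A (fun t => (rnorm (u t))%:C) (fun s => (rnorm (v s))%:C).
have vnE (w : I -> H) : l2fin A (fun i => (rnorm (w i))%:C) = vnorm A w.
  by congr Num.sqrt; apply: eq_bigr => i _; rewrite rnorm_real ger0_norm ?rnorm_ge0.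
rewrite !vnE; congr (rnorm _ <= _).
apply: eq_big_seq => s sA; apply: eq_big_seq => t tA.
rewrite [in RHS]uE [in RHS]vE betaZl betaZr conj_Creal ?complex_real//.
by rewrite /schur_product /a sA tA/=; ring.
Qed.

End OperatorEntries.

(** * Partitions of unity on bounded sets *)

Section PartitionsOfUnity.
Variables (R : realType) (F A : set R[i]) (M : R).
Hypotheses (F_nonempty : F !=set0) (AF : A `<=` F).
Hypothesis A_bounded : forall z, A z -> rnorm z <= M.

(** Cover a box that contains A by finitely many balls of radius d / 2, and move
    the centers of those that meet A to a point of A. *)
Lemma finite_net (d : R) : 0 < d ->
  exists E : {fset F}, forall z, A z -> exists2 s, s \in E & rnorm (val s - z) < d.
Proof.
move=> d0; have d20 : 0 < d / 2 by rewrite divr_gt0.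
have := @complex_box_compact R M; rewrite compact_cover.
move=> /(_ R[i] setT (fun c => [set w | rnorm (c - w) < d / 2])) [c _||E _ EP].
- rewrite openE => w /= cw; apply/nbhs_rnormP.
  exists (d / 2 - rnorm (c - w)) => [|z]; first by rewrite subr_gt0.
  by rewrite ltrBrDl; apply: le_lt_trans; exact: rnorm_triangle.
- by move=> w _; exists w => //=; rewrite subrr rnorm0.
have [z0 Fz0] := F_nonempty.
have /choice[p pP] : forall c : R[i], exists s : F, forall z, A z -> rnorm (c - z) < d / 2 ->
    rnorm (c - val s) < d / 2.
  move=> c; have [[z [Az cz]]|none] := pselect (exists z, A z /\ rnorm (c - z) < d / 2).
    by exists (SigSub (mem_set (AF Az))).
  by exists (SigSub (mem_set Fz0)) => z Az cz; case: none; exists z.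
exists [fset p c | c in E]%fset => z Az.
have [|c /= cE cz] := EP z.
  by split; apply: le_trans (A_bounded Az); [exact: normr_Re_le|exact: normr_Im_le].
exists (p c); first by rewrite in_imfset.
apply: le_lt_trans (rnorm_triangle _ c _) _.
by rewrite (splitr d) ltrD// rnormBC; exact: pP cz.
Qed.

(** Tent functions around the points of a finite net, normalized by the square
    root of the sum of their squares. *)
Lemma exists_partition (d : R) : 0 < d ->
  exists (E : {fset F}) (psi : F -> R[i] -> R[i]),
  [/\ forall s, {within A, continuous (psi s)},
      forall s z, (psi s z)^* = psi s z,
      forall z, A z -> \sum_(s <- E) psi s z ^+ 2 = 1 &
      forall s z, psi s z != 0 -> rnorm (val s - z) <= d].
Proof.
move=> d0; have [E EP] := finite_net d0.
pose phi (s : F) (z : R[i]) : R := Num.max 0 (d - rnorm (val s - z)).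
pose D z := \sum_(s <- E) phi s z ^+ 2.
have D0 z : A z -> 0 < D z.
  move=> /EP[s sE sz]; rewrite /D (perm_big _ (perm_to_rem sE))/= big_cons.
  rewrite ltr_pwDl ?sum_sqr_ge0// exprn_gt0// /phi lt_max.
  by rewrite subr_gt0 sz orbT.
have phi_lip s z w : `|phi s z - phi s w| <= rnorm (z - w).
  have := rnorm_triangle (val s) z w; have := rnorm_triangle (val s) w z.
  rewrite (rnormBC w z) /phi ler_norml => h1 h2.
  by apply/andP; split; case: (leP 0 (d - rnorm (val s - z))) => ?;
    case: (leP 0 (d - rnorm (val s - w))) => ?; have := rnorm_ge0 (z - w); lra.
have phi_cont s z : phi s w @[w --> z] --> phi s z.
  suff : forall e : R, 0 < e -> \forall w \near z, `|phi s z - phi s w| < e.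
    by move/cvgrPdist_lt.
  move=> e e0; apply/nbhs_rnormP; exists e => // w zw.
  exact: le_lt_trans (phi_lip _ _ _) zw.
have D_cont z : D w @[w --> z] --> D z.
  have FF := @nbhs_filter _ z.
  apply: cvg_big => [u|s _]; first exact: add_continuous.
  by apply: cvgM; exact: phi_cont.
exists E, (fun s z => (phi s z / Num.sqrt (D z))%:C); split.
- move=> s; apply: continuous_in_subspaceT => z /set_mem Az.
  have FF := @nbhs_filter _ z.
  have sqrt0 : Num.sqrt (D z) != 0 by rewrite sqrtr_eq0 -ltNge D0.
  have sqrt_cont : Num.sqrt (D w) @[w --> z] --> Num.sqrt (D z).
    exact: (continuous_cvg _ (@sqrt_continuous R (D z)) (@D_cont z)).
  have quot : phi s w / Num.sqrt (D w) @[w --> z] --> phi s z / Num.sqrt (D z).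
    exact: (cvgM (@phi_cont s z) (cvgV sqrt0 sqrt_cont)).
  apply: rnorm_cvg => e e0; move/cvgrPdist_lt/(_ e e0) : quot; apply: filterS => w.
  by rewrite -rmorphB/= rnorm_real.
- by move=> s z; rewrite conj_Creal ?complex_real.
- move=> z Az; under eq_bigr do rewrite -rmorphXn expr_div_n sqr_sqrtr ?(ltW (D0 z Az))//.
  by rewrite -rmorph_sum -mulr_suml divff// gt_eqF// D0.
- move=> s z; apply: contra_neqT; rewrite -ltNge /phi => dz.
  by have -> : Num.max 0 (d - rnorm (val s - z)) = 0;
    [apply/max_idPl; rewrite subr_le0 ltW|rewrite mul0r].
Qed.

End PartitionsOfUnity.

(** * Commutator estimates from Schur multipliers *)

Section Converse.
Variables (R : realType) (F : set R[i]) (f : R[i] -> R[i]).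
Hypothesis F_nonempty : F !=set0.

Lemma divided_differenceM (s t : F) :
  divided_difference f s t * (val s - val t) = f (val s) - f (val t).
Proof.
rewrite /divided_difference; have [->|st] := eqVneq s t.
  by rewrite !subrr mulr0.
by rewrite divfK// subr_eq0; apply: contra_neq st => /val_inj.
Qed.

(** The entries of a Schur multiplier are bounded by its norm. *)
Lemma schur_le_lipschitz (K : R) z w : schur_le (@divided_difference R F f) K ->
  F z -> F w -> rnorm (f z - f w) <= K * rnorm (z - w).
Proof.
move=> DK Fz Fw.
pose s : F := SigSub (mem_set Fz); pose t : F := SigSub (mem_set Fw).
have := divided_differenceM s t; rewrite /= => <-.
by rewrite rnormM ler_wpM2r ?rnorm_ge0//; exact: schur_le_entry DK.
Qed.

Lemma schur_le_continuous (K : R) (A : set R[i]) : A `<=` F ->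
  schur_le (@divided_difference R F f) K -> {within A, continuous f}.
Proof.
move=> AF DK; apply/subspace_continuousP => z Az.
apply: rnorm_cvg => e e0; apply/nbhs_rnormP.
have K1 : 0 < K + 1 by rewrite ltr_wpDl//; case: DK.
exists (e / (K + 1)) => [|w zw Aw]; first exact: divr_gt0.
apply: le_lt_trans (schur_le_lipschitz DK (AF _ Az) (AF _ Aw)) _.
move: zw; rewrite ltr_pdivlMr//; apply: le_lt_trans.
by rewrite mulrC ler_wpM2l ?rnorm_ge0// lerDl.
Qed.

(** Replace N by the diagonal operator of the points of a net of its spectrum,
    through a partition of unity. The commutator with B becomes the block
    matrix of the (s - t) P s B P t, and the divided difference multiplies its
    entries to give the blocks of the commutator of f N with B. Both
    approximations have errors of the order of the mesh d of the net. *)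
Lemma schur_le_CL_bound (K : R) :
  schur_le (@divided_difference R F f) K -> CL_bound F f K.
Proof.
move=> DK H N B fN bN nN specF bB [Phi PhiP ->]; have K0 := DK.1.
have [L L0 LE] := opnorm_bounded (commutator_bounded bN bB).
have Lle : forall x, rnorm (commutator N B x) <= L * rnorm x.
  by apply: le_opnorm; [exact: (commutator_bounded bN bB).1|rewrite LE].
have [b b0 Bb] := bounded_op_ge0 bB; have Bl := bB.1.
have [M M0 NM] := bounded_op_ge0 bN.
have specM z : spectrum N z -> rnorm z <= M by exact: spectrum_bounded bN.1 M0 NM.
have fc := schur_le_continuous specF DK.
rewrite LE -EFinM; apply: opnorm_le => [|x]; first exact: mulr_ge0.
apply: rnorm_hdot_le => [|y]; first by rewrite !mulr_ge0 ?rnorm_ge0.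
apply/ler_addgt0Pr => e e0.
pose XY := rnorm x * rnorm y.
have XY0 : 0 <= XY by rewrite mulr_ge0 ?rnorm_ge0.
have C0 : 0 <= 4 * b * K * XY by do 3!(apply: mulr_ge0 => //).
(* the errors add up to 4 * b * K * d * XY *)
pose d := e / (1 + 4 * b * K * XY).
have d0 : 0 < d by rewrite divr_gt0// ltr_pwDl.
have [A [psi [psi_cont psi_conj psi_sum psi_near]]] :=
  exists_partition F_nonempty specF specM d0.
pose P s := Phi (psi s).
have Pl s : linear (P s) by exact: (fc_linear PhiP (psi_cont s)).
have PhiN : Phi id = N by apply/funext => w; exact: (fc_id PhiP).
pose beta (s t : F) u v := (val s - val t) * hdot H (B (P t u)) (P s v).
have betaQ (u v : F -> H) :
    rnorm (\sum_(s <- A) \sum_(t <- A) beta s t (u t) (v s)) <=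
    (L + 2 * b * d) * vnorm A u * vnorm A v.
  have := partition_commutator PhiP psi_cont psi_conj psi_sum (c := fun s => val s)
    u v Bl b0 Bb (@within_continuous_id R (spectrum N)) (ltW d0)
    (fun s z _ psi0 => psi_near s z psi0).
  rewrite PhiN; set T1 := \sum_(s <- A) _; set T2 := hdot _ _ _ => T12.
  rewrite -[T1](subrK T2) (mulrDl L) (mulrDl (L * _)) [leRHS]addrC.
  apply: le_trans (rnormD_le _ _) _; apply: lerD => //.
  apply: le_trans (hdot_le _ _) _; apply: ler_pM; rewrite ?rnorm_ge0//.
    apply: le_trans (Lle _) _; rewrite ler_wpM2l//.
    exact: (partition_row_le PhiP psi_cont psi_conj psi_sum).
  exact: (partition_row_le PhiP psi_cont psi_conj psi_sum).
have betaZl s t c u v : beta s t (c *: u) v = c * beta s t u v.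
  by rewrite /beta !linear_opZ// hdotZl mulrCA.
have betaZr s t c u v : beta s t u (c *: v) = c^* * beta s t u v.
  by rewrite /beta !linear_opZ// hdotZr mulrCA.
have Q0 : 0 <= L + 2 * b * d by apply: addr_ge0 => //; apply: mulr_ge0 (ltW d0); exact: mulr_ge0.
have blocks := schur_le_forms DK Q0 betaZl betaZr betaQ (fun t => P t x) (fun s => P s y).
have px := @partition_column_le _ _ _ _ PhiP _ _ _ psi_cont psi_conj psi_sum x.
have py := @partition_column_le _ _ _ _ PhiP _ _ _ psi_cont psi_conj psi_sum y.
have f_near (s : F) z : spectrum N z -> psi s z != 0 -> rnorm (f (val s) - f z) <= K * d.
  move=> zN psi0; apply: le_trans (schur_le_lipschitz DK (set_val_in s) (specF z zN)) _.
  by rewrite ler_wpM2l// psi_near.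
have := partition_commutator PhiP psi_cont psi_conj psi_sum
  (fun t => P t x) (fun s => P s y) Bl b0 Bb fc (mulr_ge0 K0 (ltW d0)) f_near.
rewrite !(partition_sum PhiP psi_cont psi_sum).
set T1 := \sum_(s <- A) _; set T2 := hdot _ _ _ => T12.
have T1E : T1 = \sum_(s <- A) \sum_(t <- A)
    divided_difference f s t * beta s t (P t x) (P s y).
  by apply: eq_bigr => s _; apply: eq_bigr => t _; rewrite mulrA divided_differenceM.
rewrite -T1E in blocks; rewrite rnormBC in T12.
rewrite -[T2](subrK T1); apply: le_trans (rnormD_le _ _) _.
have vx0 : 0 <= vnorm A (fun t => P t x) by exact: sqrtr_ge0.
have vy0 : 0 <= vnorm A (fun s => P s y) by exact: sqrtr_ge0.
have vXY : vnorm A (fun t => P t x) * vnorm A (fun s => P s y) <= XY by exact: ler_pM.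
apply: le_trans (lerD T12 blocks) _.
set vx := vnorm A _ in vXY *; set vy := vnorm A _ in vXY *.
have -> : 2 * b * (K * d) * vx * vy + K * (L + 2 * b * d) * vx * vy =
    (4 * b * K * d + K * L) * (vx * vy) by ring.
apply: (@le_trans _ _ ((4 * b * K * d + K * L) * XY)).
  apply: ler_wpM2l => //; apply: addr_ge0; last exact: mulr_ge0.
  by apply: mulr_ge0 (ltW d0); do 2!(apply: mulr_ge0 => //).
rewrite mulrDl addrC; apply: lerD; first by rewrite /XY mulrA.
have -> : 4 * b * K * d * XY = d * (4 * b * K * XY) by ring.
by rewrite /d -mulrA ger_pMr// mulrC ler_pdivrMr ?ltr_pwDl// mul1r lerDr.
Qed.

End Converse.

(** * Schur norms and the characterization *)

Section SchurNorm.
Variables (R : realType) (S T : choiceType) (Phi : S -> T -> R[i]).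

Lemma schur_le_multiplier (K : R) : schur_le Phi K -> schur_multiplier Phi.
Proof.
move=> [K0 PhiK] a /mx_bounded_mxform_le[M aM].
exact: (mxform_le_bounded (PhiK _ _ aM)).1.
Qed.

Lemma schur_norm_le (K : R) : schur_le Phi K -> (schur_norm Phi <= K%:E)%E.
Proof.
move=> [K0 PhiK]; apply: ge_ereal_sup => _ [a /= [ab a1] <-].
by apply: mx_norm_le; rewrite -[K]mulr1; apply/PhiK/mx_norm_mxform_le.
Qed.

Lemma le_schur_norm (K : R) : schur_multiplier Phi -> 0 <= K ->
  (schur_norm Phi <= K%:E)%E -> schur_le Phi K.
Proof.
move=> Phi_mult K0 PhiK; apply: schur_le_unit => // a a1.
have ab := (mxform_le_bounded a1).1.
apply: (mx_norm_mxform_le K0 (Phi_mult _ ab)).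
apply: le_trans PhiK; apply: ereal_sup_ubound; exists a => //=.
by split=> //; exact: mx_norm_le.
Qed.

Lemma schur_norm_ge0 : (0 <= schur_norm Phi)%E.
Proof.
have a1 : mxform_le ((fun _ _ => 0) : S -> T -> R[i]) 1.
  apply: mxform_le_unit => // E G x y _ _.
  by rewrite /mxform big1 ?rnorm0// => s _; rewrite big1// => t _; rewrite !mul0r.
apply: le_trans (mx_norm_ge0 (schur_product Phi (fun _ _ => 0))) _.
apply: ereal_sup_ubound; exists (fun _ _ => 0) => //=.
by split; [exact: (mxform_le_bounded a1).1|exact: mx_norm_le].
Qed.

End SchurNorm.

Theorem theorem3p3p6 (R : realType) (F : set R[i]) (f : R[i] -> R[i])
  (F_nonempty : F !=set0) (F_perfect : perfect_set F) :
  (CL F f <->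
    (forall z, F z -> cdifferentiable_at F f z) /\
    schur_multiplier (@divided_difference R F f)) /\
  (CL F f -> CL_norm F f = schur_norm (@divided_difference R F f)).
Proof.
split; [split|] => [[_ [K K0 fK]]|[_ /schur_multiplier_le[K DK]]|[_ [K K0 fK]]].
- split=> [z Fz|]; first exact: CL_bound_differentiable F_perfect K0 fK z Fz.
  exact: schur_le_multiplier (CL_bound_schur_le F_perfect K0 fK).
- split; first exact: schur_le_continuous DK.
  by exists K; [case: DK|exact: schur_le_CL_bound].
- have DK := CL_bound_schur_le F_perfect K0 fK.
  have D0 := schur_norm_ge0 (@divided_difference R F f).
  have Dfin : schur_norm (@divided_difference R F f) \is a fin_num.
    by rewrite ge0_fin_numE// (le_lt_trans (schur_norm_le DK)) ?ltry.
  apply/le_anti/andP; split; last first.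
    apply: le_ereal_inf_tmp => _ [k /= [k0 fk] <-].
    exact: schur_norm_le (CL_bound_schur_le F_perfect k0 fk).
  apply: ereal_inf_lbound; exists (fine (schur_norm (@divided_difference R F f))).
    split; first exact: fine_ge0.
    apply: schur_le_CL_bound => //; apply: le_schur_norm; rewrite ?fine_ge0 ?fineK//.
    exact: schur_le_multiplier DK.
  by rewrite fineK.
Qed.
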